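(* Let $\mathfrak{g}$ be a simple complex Lie algebra with triangular decomposition $\mathfrak{g}=\mathfrak{n}_-\oplus\mathfrak{h}\oplus\mathfrak{n}_+$, and let $\mathfrak{b}=\mathfrak{h}\oplus\mathfrak{n}_+$ be the corresponding Borel subalgebra. Let $(\mathfrak{g}/\mathfrak{b})\ltimes\mathfrak{b}$ be the semidirect product of $\mathfrak{b}$ with the vector space $\mathfrak{g}/\mathfrak{b}$, regarded as an abelian Lie algebra (abelian ideal), relative to the action of $\mathfrak{b}$ on $\mathfrak{g}/\mathfrak{b}$ induced by the adjoint action. Then $$\operatorname{ind}\big((\mathfrak{g}/\mathfrak{b})\ltimes\mathfrak{b}\big)=\operatorname{rk}(\mathfrak{g}).$$
   Context: For a finite-dimensional Lie algebra $\mathfrak{l}$ and $\ell\in\mathfrak{l}^*$, put $\mathfrak{l}^\ell=\{x\in\mathfrak{l}:\langle\ell,[x,y]\rangle=0\text{ for all }y\in\mathfrak{l}\}$. The index of $\mathfrak{l}$ is $\operatorname{ind}(\mathfrak{l})=\min_{\ell\in\mathfrak{l}^*}\dim\mathfrak{l}^\ell$. Here $\mathfrak{h}$ is a Cartan subalgebra of $\mathfrak{g}$, $\mathfrak{n}_\pm$ are the sums of the positive/negative root spaces for a choice of positive roots, and $\operatorname{rk}(\mathfrak{g})=\dim\mathfrak{h}$. The bracket of $(\mathfrak{g}/\mathfrak{b})\ltimes\mathfrak{b}$, whose underlying space is $(\mathfrak{g}/\mathfrak{b})\times\mathfrak{b}$, is $[(u,x),(v,y)]=(x.v-y.u,[x,y])$,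 where $x.(w+\mathfrak{b})=[x,w]+\mathfrak{b}$ for $x\in\mathfrak{b}$, $w\in\mathfrak{g}$. *)

(* Defs.v *)
From HB Require Import structures.
From mathcomp Require Import all_boot all_order all_algebra.
From mathcomp Require Import complex.
From mathcomp Require Import boolp reals.

Set Implicit Arguments.
Unset Strict Implicit.
Unset Printing Implicit Defensive.

Import GRing.Theory.
Local Open Scope ring_scope.

Reserved Notation "[ 'lie' x , y ]" (at level 0, format "[ 'lie'  x ,  y ]").

HB.mixin Record Vector_isLie (K : fieldType) L of Vector K L := {
  lieb : L -> L -> L;
  lieb_linearl : forall y, linear (lieb^~ y);
  lieb_linearr : forall x, linear (lieb x);
  liexx : forall x, lieb x x = 0;
  lie_jacobi : forall x y z,
    lieb x (lieb y z) + lieb y (lieb z x) + lieb z (lieb x y) = 0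
}.

#[short(type="lieAlgType")]
HB.structure Definition LieAlgebra (K : fieldType) :=
  {L of Vector_isLie K L & Vector K L}.

Notation "[ 'lie' x , y ]" := (lieb x y) : ring_scope.

Section LieTheory.
Variables (K : fieldType) (L : lieAlgType K).
Implicit Types (x y z : L) (U V : {vspace L}) (ell : 'Hom(L, K^o)).

HB.instance Definition _ x := GRing.isLinear.Build K L L _ (lieb x)
  (lieb_linearr x).

Lemma lieDl x y z : [lie x + y, z] = [lie x, z] + [lie y, z].
Proof. by have := lieb_linearl z 1 x y; rewrite !scale1r. Qed.

Lemma lie0l x : [lie 0, x] = 0.
Proof. by apply: (addrI [lie 0, x]); rewrite -lieDl !addr0. Qed.

Lemma lieZl a x y : [lie a *: x, y] = a *: [lie x, y].
Proof. by have := lieb_linearl y a x 0; rewrite lie0l !addr0. Qed.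

Lemma lieC x y : [lie x, y] = - [lie y, x].
Proof.
apply/eqP; rewrite -addr_eq0; apply/eqP.
by have := liexx (x + y); rewrite lieDl !linearD /= !liexx add0r addr0.
Qed.

Lemma lie_act_lie x y z :
  [lie [lie x, y], z] = [lie x, [lie y, z]] - [lie y, [lie x, z]].
Proof.
have := lie_jacobi x y z; rewrite (lieC z [lie x, y]) (lieC z x) linearN /=.
by move/eqP; rewrite subr_eq0 => /eqP <-.
Qed.

Definition ad x : 'End(L) := linfun (lieb x).

Lemma adE x y : ad x y = [lie x, y]. Proof. by rewrite lfunE. Qed.

(* [U, V]; by bilinearity, brackets of basis vectors suffice. *)
Definition liev U V : {vspace L} :=
  <<[seq [lie u, v] | u <- vbasis U, v <- vbasis V]>>%VS.

Fixpoint lcs U (n : nat) : {vspace L} :=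
  if n is n'.+1 then liev U (lcs U n') else U.

Definition lie_nilpotent U : Prop := exists n, lcs U n = 0%VS.

Definition lie_closed U : Prop := {in U &, forall x y, [lie x, y] \in U}.

Definition lie_ideal U : Prop := forall x y, y \in U -> [lie x, y] \in U.

Record lie_subalg := LieSubalg {
  lsval :> {vspace L};
  lsvalP : lie_closed lsval
}.

(* A nilpotent self-normalizing subalgebra. *)
Definition is_cartan U : Prop :=
  [/\ lie_closed U, lie_nilpotent U
    & forall x, (forall y, y \in U -> [lie x, y] \in U) -> x \in U].

(* coad ell x is the linear form y |-> ell [x, y]. *)
Definition coad (ell : 'Hom(L, K^o)) x : 'Hom(L, K^o) := (ell \o ad x)%VF.

Lemma coadE ell x y : coad ell x y = ell [lie x, y].
Proof. by rewrite lfunE /= adE. Qed.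

Fact coad_is_linear ell : linear (coad ell).
Proof.
move=> a u v; apply/lfunP => w.
by rewrite coadE lieDl lieZl linearP !lfunE /= !coadE lfunE /= coadE.
Qed.
HB.instance Definition _ ell := GRing.isLinear.Build K L 'Hom(L, K^o) _
  (coad ell) (coad_is_linear ell).

Definition coad_stab ell : {vspace L} := lker (linfun (coad ell)).

Lemma coad_stabP ell x :
  reflect (forall y, ell [lie x, y] = 0) (x \in coad_stab ell).
Proof.
rewrite memv_ker lfunE /=; apply: (iffP eqP) => [/lfunP e y | e].
  by rewrite -coadE e lfunE.
by apply/lfunP => y; rewrite coadE e lfunE.
Qed.

Definition stab_dim (n : nat) : bool :=
  `[< exists ell : 'Hom(L, K^o), \dim (coad_stab ell) = n >].

Lemma exists_stab_dim : exists n, stab_dim n.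
Proof. by exists (\dim (coad_stab 0)); apply/asboolP; exists 0. Qed.

Definition ind : nat := ex_minn exists_stab_dim.

Lemma ind_le ell : (ind <= \dim (coad_stab ell))%N.
Proof.
by rewrite /ind; case: ex_minnP => n _; apply; apply/asboolP; exists ell.
Qed.

Lemma ind_attained : exists ell, \dim (coad_stab ell) = ind.
Proof. by rewrite /ind; case: ex_minnP => n /asboolP. Qed.

End LieTheory.

Arguments ind {K} L.

Definition lie_simple (K : fieldType) (L : lieAlgType K) : Prop :=
  (exists x y : L, [lie x, y] != 0) /\
  (forall I : {vspace L}, lie_ideal I -> I = 0%VS \/ I = fullv).

Section Subalgebra.
Variables (K : fieldType) (L : lieAlgType K) (b : lie_subalg L).

Definition subvs_lieb (x y : subvs_of b) : subvs_of b :=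
  Subvs (lsvalP (subvsP x) (subvsP y)).

Fact subvs_lieb_linearl y : linear (subvs_lieb^~ y).
Proof. by move=> a u v; apply: val_inj; rewrite /= lieDl lieZl. Qed.
Fact subvs_lieb_linearr x : linear (subvs_lieb x).
Proof. by move=> a u v; apply: val_inj; rewrite /= linearP. Qed.
Fact subvs_liexx x : subvs_lieb x x = 0.
Proof. by apply: val_inj; rewrite /= liexx. Qed.
Fact subvs_jacobi x y z : subvs_lieb x (subvs_lieb y z) +
  subvs_lieb y (subvs_lieb z x) + subvs_lieb z (subvs_lieb x y) = 0.
Proof. by apply: val_inj; rewrite /= lie_jacobi. Qed.

HB.instance Definition _ := Vector_isLie.Build K (subvs_of b)
  subvs_lieb_linearl subvs_lieb_linearr subvs_liexx subvs_jacobi.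

End Subalgebra.

Section QuotientSpace.
Variables (K : fieldType) (V : vectType K) (U : {vspace V}).
Local Open Scope quotient_scope.

Definition quotv : Type := Quotient.quot (pred_of_vspace U).

HB.instance Definition _ := GRing.Zmodule.on quotv.
HB.instance Definition _ := EqQuotient.on quotv.

Definition piv (v : V) : quotv := \pi_quotv v.

Lemma reprK_piv (w : quotv) : piv (repr w) = w. Proof. exact: reprK. Qed.

Lemma eq_pivP (v w : V) : reflect (piv v = piv w) (v - w \in U).
Proof. by rewrite (Quotient.idealrBE (pred_of_vspace U)); apply: eqP. Qed.

Lemma pivD v w : piv (v + w) = piv v + piv w.
Proof. exact: (Quotient.pi_add (pred_of_vspace U)). Qed.

Definition quotv_scale (a : K) (w : quotv) : quotv := piv (a *: repr w).

Lemma pivZ a v : piv (a *: v) = quotv_scale a (piv v).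
Proof.
apply/eq_pivP; rewrite -scalerBr memvZ //.
by apply/eq_pivP; rewrite reprK_piv.
Qed.

Fact quotv_scaleA a b w :
  quotv_scale a (quotv_scale b w) = quotv_scale (a * b) w.
Proof. by rewrite -(reprK_piv w) -!pivZ scalerA. Qed.
Fact quotv_scale1 : left_id 1 quotv_scale.
Proof. by move=> w; rewrite -(reprK_piv w) -!pivZ scale1r. Qed.
Fact quotv_scaleDr : right_distributive quotv_scale +%R.
Proof.
move=> a v w.
by rewrite -(reprK_piv v) -(reprK_piv w) -pivD -!pivZ -pivD scalerDr.
Qed.
Fact quotv_scaleDl w : {morph quotv_scale^~ w : a b / a + b}.
Proof. by move=> a b; rewrite -(reprK_piv w) -!pivZ -pivD scalerDl. Qed.

HB.instance Definition _ := GRing.Zmodule_isLmodule.Build K quotv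
  quotv_scaleA quotv_scale1 quotv_scaleDr quotv_scaleDl.

Lemma piv_is_linear : linear piv.
Proof. by move=> a v w; rewrite pivD pivZ. Qed.
HB.instance Definition _ := GRing.isLinear.Build K V quotv _ piv piv_is_linear.

(* The complement U^C maps isomorphically onto V / U. *)
Fact quotv_vect_iso : Vector.axiom (\dim U^C) quotv.
Proof.
have [h h_lin h_bij] := subvs_vect_iso U^C.
pose g : 'End(V) := (\1 - projv U)%VF.
have gE v : g v = v - projv U v by rewrite !lfunE /= !lfunE.
have gU u : u \in U -> g u = 0 by move=> Uu; rewrite gE projv_id ?subrr.
pose f (w : quotv) : subvs_of U^C := vsproj U^C (g (repr w)).
have fE v : f (piv v) = vsproj U^C (g v).
  rewrite /f; congr (vsproj _ _); apply/eqP; rewrite -subr_eq0 -linearB /=.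
  by rewrite gU //; apply/eq_pivP; rewrite reprK_piv.
have f_lin : linear f.
  by move=> a v w; rewrite -(reprK_piv v) -(reprK_piv w) -piv_is_linear !fE !linearP.
have f_bij : bijective f.
  exists (piv \o vsval) => [w | u] /=.
    rewrite vsprojK; last by rewrite gE memv_projC.
    rewrite -[RHS](reprK_piv w); apply/eq_pivP.
    by rewrite gE addrAC subrr add0r memvN memv_proj.
  rewrite fE; apply: val_inj; rewrite /= vsprojK; last by rewrite gE memv_projC.
  rewrite gE; apply/eqP; rewrite subr_eq addrC -subr_eq subrr eq_sym.
  by rewrite -memv_ker lker_proj subvsP.
exists (h \o f); last exact: bij_comp.
by move=> a v w /=; rewrite f_lin h_lin.
Qed.

HB.instance Definition _ := Lmodule_hasFinDim.Build K quotv quotv_vect_iso.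

End QuotientSpace.

Record lie_rep (K : fieldType) (L : lieAlgType K) (V : vectType K) := LieRep {
  rep_act :> L -> V -> V;
  rep_linearl : forall v, linear (rep_act^~ v);
  rep_linearr : forall x, linear (rep_act x);
  rep_lie : forall x y v,
    rep_act [lie x, y] v = rep_act x (rep_act y v) - rep_act y (rep_act x v)
}.

(* The underlying space of the semidirect product of L with the representation
   rho on V, in which V is an abelian ideal. *)
Definition semidirect (K : fieldType) (L : lieAlgType K) (V : vectType K)
  (rho : lie_rep L V) : Type := (V * L)%type.

Section Semidirect.
Variables (K : fieldType) (L : lieAlgType K) (V : vectType K).
Variable rho : lie_rep L V.
Local Notation semidirect := (semidirect rho).

HB.instance Definition _ := Vector.copy semidirect (V * L)%type.

Definition semidirect_lieb (p q : semidirect) : semidirect :=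
  (rho p.2 q.1 - rho q.2 p.1, [lie p.2, q.2]).

HB.instance Definition _ x := GRing.isLinear.Build K V V _ (rho x)
  (rep_linearr rho x).

Fact rep_actDZ a x y v : rho (a *: x + y) v = a *: rho x v + rho y v.
Proof. exact: rep_linearl. Qed.

Fact semidirect_linearl q : linear (semidirect_lieb^~ q).
Proof.
move=> a u v; congr pair; rewrite /= ?lieDl ?lieZl //.
by rewrite rep_actDZ linearP scalerBr opprD addrACA.
Qed.
Fact semidirect_linearr p : linear (semidirect_lieb p).
Proof.
move=> a u v; congr pair; rewrite /= ?linearP //.
by rewrite rep_actDZ scalerBr opprD addrACA.
Qed.
Fact semidirect_liexx p : semidirect_lieb p p = 0.
Proof. by rewrite /semidirect_lieb subrr liexx. Qed.
Fact semidirect_jacobi p q r :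
  semidirect_lieb p (semidirect_lieb q r) +
  semidirect_lieb q (semidirect_lieb r p) +
  semidirect_lieb r (semidirect_lieb p q) = 0.
Proof.
congr pair; last exact: lie_jacobi.
have E (a b c d e f : V) :
    (a - b - (c - d)) + (c - e - (f - b)) + (f - d - (a - e)) = 0.
  rewrite !opprB [c - e + _]addrC [a - b + _ + _]addrACA !subrKA.
  by rewrite addrACA !subrKA subrr.
by rewrite /= !linearB /= !rep_lie; apply: E.
Qed.

HB.instance Definition _ := Vector_isLie.Build K semidirect
  semidirect_linearl semidirect_linearr semidirect_liexx semidirect_jacobi.

End Semidirect.

Section QuotientRep.
Variables (K : fieldType) (L : lieAlgType K) (b : lie_subalg L).

(* The action of b on L / b induced by the adjoint action. *)
Definition quot_act (x : subvs_of b) (w : quotv b) : quotv b :=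
  piv b [lie vsval x, repr w].

Lemma quot_actE x w : quot_act x (piv b w) = piv b [lie vsval x, w].
Proof.
apply/eq_pivP; rewrite -linearB /=; apply: lsvalP; first exact: subvsP.
by apply/eq_pivP; rewrite reprK_piv.
Qed.

Fact quot_act_linearl w : linear (quot_act^~ w).
Proof. by move=> a x y; rewrite /quot_act lieDl lieZl linearP. Qed.
Fact quot_act_linearr x : linear (quot_act x).
Proof.
move=> a v w; rewrite -(reprK_piv v) -(reprK_piv w) -linearP !quot_actE.
by rewrite !linearP.
Qed.
Fact quot_act_lie x y w :
  quot_act [lie x, y] w = quot_act x (quot_act y w) - quot_act y (quot_act x w).
Proof.
by rewrite -(reprK_piv w) !quot_actE -linearB /= -lie_act_lie.
Qed.

Definition quot_rep : lie_rep (subvs_of b) (quotv b) :=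
  LieRep quot_act_linearl quot_act_linearr quot_act_lie.

(* The bracket of (L / b) >| b, written out. *)
Lemma quot_semidirectE (u v : L) (x y : subvs_of b) :
  [lie ((piv b u, x) : semidirect quot_rep), ((piv b v, y) : semidirect quot_rep)]
  = (piv b [lie vsval x, v] - piv b [lie vsval y, u], [lie x, y]).
Proof. by rewrite -!quot_actE. Qed.

End QuotientRep.

Section Roots.
Variables (K : fieldType) (g : lieAlgType K) (h : {vspace g}).
Local Notation weight := 'Hom(subvs_of h, K^o).
Implicit Types a b : weight.

(* The x with [t, x] = a(t) x for all t in h; see root_spaceP. *)
Definition root_space a : {vspace g} :=
  (\bigcap_(t <- vbasis {:subvs_of h}) passmx.leigenspace (ad (vsval t)) (a t))%VS.

Lemma root_spaceP a x :
  reflect (forall t : subvs_of h, [lie vsval t, x] = (a t : K) *: x)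
    (x \in root_space a).
Proof.
have memE (t : subvs_of h) :
    (x \in passmx.leigenspace (ad (vsval t)) (a t)) =
    ([lie vsval t, x] == (a t : K) *: x).
  by rewrite memv_ker add_lfunE opp_lfunE scale_lfunE id_lfunE adE subr_eq0.
have capE (s : seq (subvs_of h)) :
    (x \in (\bigcap_(t <- s) passmx.leigenspace (ad (vsval t)) (a t))%VS) =
    all (fun t => [lie vsval t, x] == (a t : K) *: x) s.
  elim: s => [|t s IHs]; first by rewrite big_nil memvf.
  by rewrite big_cons memv_cap memE IHs.
rewrite capE; apply: (iffP allP) => [e t | e t _]; last exact/eqP.
rewrite (coord_vbasis (memvf t)) !linear_sum /= scaler_suml.
rewrite -[LHS]opprK -lieC linear_sum -sumrN; apply: eq_bigr => i _.
rewrite !linearZ /= -lieC -[RHS]scalerA; congr (_ *: _).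
by apply/eqP/e/mem_nth; rewrite size_tuple.
Qed.

Lemma lie_root_space a b x y :
  x \in root_space a -> y \in root_space b ->
  [lie x, y] \in root_space (a + b).
Proof.
move=> /root_spaceP ax /root_spaceP bY; apply/root_spaceP => t.
rewrite -[LHS](subrK [lie x, [lie vsval t, y]]) -lie_act_lie ax bY.
by rewrite lieZl linearZ /= lfunE scalerDl.
Qed.

Definition is_root a : bool := (a != 0) && (root_space a != 0%VS).

(* A choice of positive roots: the finite set of the entries of P contains
   exactly one of a, - a for each root a, and a + b whenever a, b are positive
   and a + b is a root. *)
Record positive_system (P : seq weight) : Prop := {
  pos_uniq : uniq P;
  pos_root : {in P, forall a, is_root a};
  pos_or_neg : forall a, is_root a -> (a \in P) (+) (- a \in P);
  pos_add : {in P &, forall a b, is_root (a + b) -> a + b \in P}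
}.

Definition n_plus (P : seq weight) : {vspace g} :=
  (\sum_(a <- P) root_space a)%VS.
Definition n_minus (P : seq weight) : {vspace g} :=
  (\sum_(a <- P) root_space (- a))%VS.

(* directv looks inside its argument; with U, V, W abstract it only asserts that
   the three-term sum is direct. *)
Definition decomposes (U V W : {vspace g}) : Prop :=
  (U + V + W = fullv)%VS /\ directv (U + V + W).

(* g = n_- (+) h (+) n_+ *)
Record triangular_decomposition (P : seq weight) : Prop := {
  td_cartan : is_cartan h;
  td_pos : positive_system P;
  td_sum : decomposes (n_minus P) h (n_plus P)
}.

Fact borel_closed P : triangular_decomposition P -> lie_closed (h + n_plus P)%VS.
Proof.
case=> -[hh _ _] [uP rP dP aP] _.
have hn x y : x \in h -> y \in n_plus P -> [lie x, y] \in n_plus P.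
  move=> hx; rewrite /n_plus -[x](vsprojK hx); move: (vsproj h x) => t.
  elim: (P) y => [|a s IHs] y; first by rewrite !big_nil !memv0 => /eqP->; rewrite linear0.
  rewrite !big_cons => /memv_addP[u /root_spaceP au [v sv ->]].
  by rewrite linearD memv_add ?IHs //= au memvZ //; apply/root_spaceP.
have na s a x y : {subset s <= P} -> a \in P -> x \in root_space a ->
    y \in (\sum_(b <- s) root_space b)%VS -> [lie x, y] \in n_plus P.
  move=> + Pa ax; elim: s y => [|b s IHs] y sP.
    by rewrite big_nil memv0 => /eqP->; rewrite linear0 mem0v.
  rewrite big_cons => /memv_addP[u bu [v sv ->]]; rewrite linearD memvD //=.
    have Pb : b \in P by apply: sP; rewrite mem_head.
    have := lie_root_space ax bu; case: (eqVneq (a + b) 0) => [ab0 | ab0].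
      have /eqP := ab0; rewrite addr_eq0 => /eqP ab.
      by have := dP _ (rP _ Pb); rewrite -ab Pa Pb.
    case: (eqVneq (root_space (a + b)) 0%VS) => [->|rab].
      by rewrite memv0 => /eqP->; rewrite mem0v.
    have Pab : a + b \in P by apply: aP => //; rewrite /is_root ab0.
    by apply: subvP; rewrite /n_plus (big_rem _ Pab) addvSl.
  by apply: IHs => // c sc; apply: sP; rewrite inE sc orbT.
have nn x y : x \in n_plus P -> y \in n_plus P -> [lie x, y] \in n_plus P.
  move=> + Py; rewrite {1}/n_plus.
  have: {subset P <= P} by [].
  elim: {1 3}(P) x => [|a s IHs] x sP.
    by rewrite big_nil memv0 => /eqP->; rewrite lie0l mem0v.
  rewrite big_cons => /memv_addP[u au [v sv ->]]; rewrite lieDl memvD //.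
    by apply: (na P a) => //; apply: sP; rewrite mem_head.
  by apply: IHs => // c sc; apply: sP; rewrite inE sc orbT.
move=> _ _ /memv_addP[x hx [u nu ->]] /memv_addP[y hy [v nv ->]].
rewrite lieDl !linearD /= -addrA memv_add ?hh //.
rewrite memvD ?hn // memvD //; last exact: nn.
by rewrite lieC memvN hn.
Qed.

Definition borel P (td : triangular_decomposition P) : lie_subalg g :=
  LieSubalg (borel_closed td).

End Roots.

(* Main.v *)
Require Import Defs.
From HB Require Import structures.
From mathcomp Require Import all_boot all_order all_algebra.
From mathcomp Require Import complex reals.
From mathcomp Require Import boolp ring.

(** Write q for the semidirect product; the index is governed by the ranks of the
    alternating forms (x, y) |-> l [x, y].

    Lower bound: the brackets of q are the limit s -> 0 of those of g transported
    by the map that is s on n_- and 1 on b, and rank is lower semicontinuous,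
    so it suffices to bound ranks on g.  The Killing form is nondegenerate (by a
    string computation), so every form of g is that of some ad x; the differentials
    of x |-> tr (ad x)^k annihilate [x, g], and they span a space of dimension at
    least dim h at a generic point of h (Vandermonde), hence generically.

    Upper bound: take l = kappa(e, -) on g / b and 0 on b, where e is the sum of the
    simple root vectors.  As ad e is injective on n_- by sl2 theory, n_- pairs
    nondegenerately with b, and the stabilizer has dimension dim b - dim n_-.  The
    principal sl2 exists as the simple roots are independent; without Weyl groups,
    this follows from (2 rho, b) > 0 for all positive b, itself a trace computation
    on b-strings. *)

Set Implicit Arguments.
Unset Strict Implicit.
Unset Printing Implicit Defensive.

Import Order.TTheory GRing.Theory Num.Theory.
Local Open Scope ring_scope.

(** * Generic values of polynomials and ranks *)

(** The [size p] numbers 0, 1, 2, ... are distinct in characteristic 0, which is one more than [p]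
    can have roots. *)
Lemma exists_nonroot (K : numFieldType) (p : {poly K}) :
  p != 0 -> exists s, p.[s] != 0.
Proof.
move=> p0; apply: contrapT => np.
pose s := [seq i%:R : K | i <- iota 0 (size p)].
suff /(max_poly_roots p0) h : all (root p) s.
  suff /h : uniq s by rewrite size_map size_iota ltnn.
  by rewrite map_inj_uniq ?iota_uniq // => i j /eqP; rewrite eqr_nat => /eqP.
apply/allP => _ /mapP[i _ ->]; rewrite /root; apply/eqP; apply: contrapT => /eqP h.
  by apply: np; exists i%:R.
Qed.

(** By induction: if [x] works for [s] and [a] does not vanish at [y], each form restricts to a
    nonzero polynomial on the line x + c y, and a c outside the roots of their product works for all
    of them. *)
Lemma exists_nonvanishing (K : numFieldType) (V : vectType K)
    (s : seq 'Hom(V, K^o)) :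
  0 \notin s -> exists v, forall a, a \in s -> (a v : K) != 0.
Proof.
elim: s => [|a s IHs]; first by exists 0.
rewrite inE negb_or eq_sym => /andP[a0 /IHs[x xs]].
have [y ay] : exists y, (a y : K) != 0.
  apply: contrapT => na; case/eqP: a0; apply/lfunP => y; rewrite lfunE /=.
  by apply: contrapT => /eqP ay; apply: na; exists y.
pose q (b : 'Hom(V, K^o)) : {poly K} := (b x : K)%:P + (b y : K) *: 'X.
have qE b c : (q b).[c] = (b (x + c *: y) : K).
  by rewrite /q !hornerE linearD linearZ /= mulrC.
have q0 b : b \in a :: s -> q b != 0.
  rewrite inE => /predU1P[->|/xs bx]; apply/eqP => q0.
    have: (q a)`_1 = 0 by rewrite q0 coef0.
    by rewrite /q coefD coefC coefZ coefX /= add0r mulr1; apply/eqP.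
  by have := qE b 0; rewrite q0 horner0 scale0r addr0 => /esym/eqP; apply/negP.
have : \prod_(b <- a :: s) q b != 0 by rewrite prodf_seq_neq0; apply/allP.
case/exists_nonroot => c; rewrite horner_prod prodf_seq_neq0 => /allP cs.
by exists (x + c *: y) => b /cs; rewrite qE.
Qed.

Lemma mxrank_det_mxsub (K : fieldType) m n k (A : 'M[K]_(m, n))
    (f : 'I_k -> 'I_m) (f' : 'I_k -> 'I_n) :
  \det (mxsub f f' A) != 0 -> (k <= \rank A)%N.
Proof.
rewrite -unitfE -unitmxE => /mxrank_unit <-.
have -> : mxsub f f' A = rowsub f 1%:M *m A *m colsub f' 1%:M.
  by rewrite mul_rowsub_mx mul1mx mulmx_colsub mulmx1; apply/matrixP => i j; rewrite !mxE.
exact: leq_trans (mxrankM_maxl _ _) (mxrankM_maxr _ _).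
Qed.

Lemma mxrank_det_mxsub_exists (K : fieldType) m n (A : 'M[K]_(m, n)) :
  exists (f : 'I_(\rank A) -> 'I_m) (f' : 'I_(\rank A) -> 'I_n),
    \det (mxsub f f' A) != 0.
Proof.
pose B := rowsub (maxrankfun A) A.
have rB : row_free B by apply: maxrowsub_free.
have rBT : row_full B^T by rewrite /row_full mxrank_tr.
exists (maxrankfun A), (fullrankfun rBT).
rewrite -unitfE -unitmxE -unitmx_tr.
have -> : (mxsub (maxrankfun A) (fullrankfun rBT) A)^T = rowsub (fullrankfun rBT) B^T.
  by apply/matrixP => i j; rewrite !mxE.
exact: fullrowsub_unit.
Qed.

(* Rank is lower semicontinuous: it can drop only at the zeros of a minor. *)
Lemma mxrank_horner_generic (K : fieldType) m n (A : 'M[{poly K}]_(m, n)) a :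
  exists2 p : {poly K}, p.[a] != 0 & forall s, p.[s] != 0 ->
    (\rank (map_mx (horner_eval a) A) <= \rank (map_mx (horner_eval s) A))%N.
Proof.
have [f [f' d]] := mxrank_det_mxsub_exists (map_mx (horner_eval a) A).
have E s : \det (mxsub f f' (map_mx (horner_eval s) A)) = (\det (mxsub f f' A)).[s].
  by rewrite -map_mxsub det_map_mx.
exists (\det (mxsub f f' A)) => [|s]; first by rewrite -E.
by rewrite -E; apply: mxrank_det_mxsub.
Qed.

(** Labels rather than vectors are selected, so that each vector of the extracted basis keeps its
    weight in [exists_weight_basis]. *)
Lemma free_subseq (K : fieldType) (V : vectType K) (T : eqType) (f : T -> V)
    (s : seq T) :
  exists s' : seq T, [/\ {subset s' <= s}, free (map f s')
    & <<map f s'>>%VS = <<map f s>>%VS].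
Proof.
elim: s => [|x s [s' [ss fs es]]]; first by exists [::]; split; rewrite // nil_free.
case: (boolP (f x \in <<map f s'>>%VS)) => h.
  exists s'; split => //; first by move=> y /ss; rewrite inE orbC => ->.
  rewrite /= span_cons -es; apply/esym/addv_idPr.
  by rewrite -memvE.
exists (x :: s'); split; first by move=> y; rewrite !inE => /orP[->//|/ss->]; rewrite orbT.
  by rewrite /= free_cons h.
by rewrite /= !span_cons es.
Qed.

Lemma sum_neq0_exists (V : zmodType) (I : finType) (F : I -> V) :
  \sum_i F i != 0 -> exists i, F i != 0.
Proof.
move=> nz; apply: contrapT => no; case/eqP: nz; apply: big1 => i _.
by apply: contrapT => /eqP ni; apply: no; exists i.
Qed.

(** * Weights and weight bases *)

Lemma sumv_seq_sub (K : fieldType) (V : vectType K) (T : eqType) (s : seq T)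
    (U : T -> {vspace V}) (W : {vspace V}) :
  {in s, forall a, U a <= W}%VS -> (\sum_(a <- s) U a <= W)%VS.
Proof.
move=> h; rewrite big_seq; elim/big_rec: _ => [|a u /h aW uW]; first exact: sub0v.
by rewrite subv_add aW.
Qed.

Lemma sumv_seq_sup (K : fieldType) (V : vectType K) (T : eqType) (s : seq T)
    (U : T -> {vspace V}) a :
  a \in s -> (U a <= \sum_(b <- s) U b)%VS.
Proof. by move=> sa; rewrite (big_rem _ sa) addvSl. Qed.

Lemma memv_bigcap_seq (K : fieldType) (V : vectType K) (T : eqType) (s : seq T)
    (U : T -> {vspace V}) x :
  (x \in \bigcap_(a <- s) U a)%VS = all (fun a => x \in U a) s.
Proof.
elim: s => [|a s IHs]; first by rewrite big_nil memvf.
by rewrite big_cons memv_cap IHs.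
Qed.

Lemma lie_suml (K : fieldType) (L : lieAlgType K) (I : Type) (r : seq I)
    (S : pred I) (F : I -> L) y :
  [lie \sum_(i <- r | S i) F i, y] = \sum_(i <- r | S i) [lie F i, y].
Proof. exact: (big_morph (fun x => [lie x, y]) (fun u v => lieDl u v y) (lie0l y)). Qed.

Lemma mem_liev (K : fieldType) (L : lieAlgType K) (U V : {vspace L}) x y :
  x \in U -> y \in V -> [lie x, y] \in liev U V.
Proof.
move=> Ux Vy; rewrite (coord_vbasis Ux) (coord_vbasis Vy).
elim/big_rec: _ => [|i u _ IH]; first by rewrite lie0l mem0v.
rewrite lieDl lieZl memvD ?memvZ // linear_sum /=; apply: memv_suml => j _.
rewrite linearZ /= memvZ //; apply/memv_span/allpairs_f; apply: mem_nth;
by rewrite size_tuple.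
Qed.

Lemma liev_simple (K : fieldType) (L : lieAlgType K) :
  lie_simple L -> liev fullv fullv = fullv :> {vspace L}.
Proof.
case=> -[x [y xy]] simp.
have I : lie_ideal (liev fullv (fullv : {vspace L})).
  by move=> u v _; apply: mem_liev; rewrite memvf.
case: (simp _ I) => // e; move: (mem_liev (memvf x) (memvf y)).
by rewrite e memv0 (negPf xy).
Qed.

Lemma simple_not_nilpotent (K : fieldType) (L : lieAlgType K) :
  lie_simple L -> ~ lie_nilpotent (fullv : {vspace L}).
Proof.
move=> simp [n lcs0]; have [[x [y xy]] _] := simp.
have {lcs0}: (fullv : {vspace L}) = 0%VS.
  by rewrite -lcs0; elim: {lcs0} n => //= n <-; rewrite liev_simple.
by move=> f0; have := memvf [lie x, y]; rewrite f0 memv0 (negPf xy).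
Qed.

Section Weights.
Variables (K : fieldType) (g : lieAlgType K) (h : {vspace g}).
Local Notation weight := 'Hom(subvs_of h, K^o).
Implicit Types (a b : weight) (t x y : g).

(** A weight is a form on the subtype [subvs_of h]; composing with the projection onto [h] lets it
    be evaluated at any element of [g]. *)
Definition ev a t : K := a (vsproj h t).

Lemma evD a b t : ev (a + b) t = ev a t + ev b t.
Proof. by rewrite /ev lfunE. Qed.
Lemma evN a t : ev (- a) t = - ev a t.
Proof. by rewrite /ev lfunE. Qed.
Lemma ev0 t : ev 0 t = 0. Proof. by rewrite /ev lfunE. Qed.
Lemma evB a b t : ev (a - b) t = ev a t - ev b t.
Proof. by rewrite evD evN. Qed.
Lemma evMn a n t : ev (a *+ n) t = n%:R * ev a t.
Proof.
elim: n => [|n IH]; first by rewrite mulr0n ev0 mul0r.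
by rewrite mulrS evD IH mulrS mulrDl mul1r.
Qed.
Lemma evMz a (z : int) t : ev (a *~ z) t = z%:~R * ev a t.
Proof. by case: z => n; rewrite /intmul /= ?evN evMn // mulNr. Qed.

Fact ev_is_linear a : linear_for *%R (ev a).
Proof. by move=> c t u; rewrite /ev !linearP. Qed.
HB.instance Definition _ a :=
  GRing.isLinear.Build K g K *%R (ev a) (ev_is_linear a).

Lemma root_spaceE a x t : x \in root_space a -> t \in h -> [lie t, x] = ev a t *: x.
Proof. by move=> /root_spaceP ax ht; rewrite -ax vsprojK. Qed.

Lemma ev_inj a b : {in h, ev a =1 ev b} -> a = b.
Proof.
move=> e; apply/lfunP => t; have := e _ (subvsP t).
by rewrite /ev vsvalK.
Qed.
End Weights.

Section Triangular.
Variables (K : fieldType) (g : lieAlgType K) (h : {vspace g}).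
Variable P : seq 'Hom(subvs_of h, K^o).
Hypotheses (g_simple : lie_simple g) (td : triangular_decomposition P).

Lemma triangular_mem x :
  exists u t v, [/\ u \in n_minus P, t \in h, v \in n_plus P & x = u + t + v].
Proof.
have [_ _ [s _]] := td; have := memvf x; rewrite -s.
case/memv_addP => w /memv_addP[u nu [t ht ->]] [v nv ->].
by exists u, t, v.
Qed.

(* The elements of h killed by all roots form an ideal. *)
Lemma roots_separate t : t \in h -> (forall a, a \in P -> ev a t = 0) -> t = 0.
Proof.
have [[hh nilh _] [_ rP _ _] _] := td.
pose Z := (h :&: \bigcap_(a <- P) lker (linfun (ev a : g -> K^o)))%VS.
have ZP x : reflect (x \in h /\ forall a, a \in P -> ev a x = 0) (x \in Z).
  rewrite memv_cap memv_bigcap_seq; apply: (iffP andP) => -[hx] /=.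
    by move=> /allP e; split=> // a /e; rewrite memv_ker lfunE => /eqP.
  by move=> e; split=> //; apply/allP => a /e; rewrite memv_ker lfunE /= => ->.
have I : lie_ideal Z.
  move=> x z /ZP[hz az]; have [u [s [v [nu hs nv ->]]]] := triangular_mem x.
  (* All roots vanish at [z], so [z] commutes with n_- and n_+, and only [s, z] survives. *)
  rewrite !lieDl; suff [-> ->] : [lie u, z] = 0 /\ [lie v, z] = 0.
    rewrite add0r addr0; apply/ZP; split=> [|a Pa]; first exact: hh.
    have /andP[_ ra] := rP _ Pa.
    have x0 : vpick (root_space a) != 0 by rewrite vpick0.
    apply/eqP; have /eqP := root_spaceE (memv_pick (root_space a)) (hh _ _ hs hz).
    rewrite eq_sym lie_act_lie !(root_spaceE (memv_pick _)) // az // scale0r linear0 linearZ /=.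
    by rewrite (root_spaceE (memv_pick _)) // az // scale0r scaler0 subrr scaler_eq0 (negPf x0) orbF.
  have sub (b : 'Hom(subvs_of h, K^o) -> 'Hom(subvs_of h, K^o)) w :
     (forall a, a \in P -> ev (b a) z = 0) ->
     w \in (\sum_(a <- P) root_space (b a))%VS -> [lie w, z] = 0.
    move=> bz nw; apply/eqP; rewrite lieC oppr_eq0 -memv0 -adE.
    suff: w \in lker (ad z) by rewrite memv_ker memv0.
    apply: subvP nw; apply: sumv_seq_sub => a Pa; apply/subvP => y ay.
    by rewrite memv_ker adE (root_spaceE ay) // bz // scale0r.
  split; last by apply: (sub id).
  by apply: (sub -%R) => // a Pa; rewrite evN az ?oppr0.
move=> ht at0; have: t \in Z by apply/ZP.
(* If this ideal were the whole algebra, [g] = [h] would be nilpotent. *)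
case: (g_simple.2 Z I) => [->|Zf]; first by rewrite memv0 => /eqP.
have hf : h = fullv by apply/eqP; rewrite eqEsubv subvf -Zf capvSl.
by rewrite hf in nilh; case: (simple_not_nilpotent g_simple).
Qed.

(** On each root space [y, z] acts as the commutator of two scalars, hence by 0, and an element of
    [h] killed by all roots is 0. *)
Lemma cartan_abelian : (h <= root_space (0%R : 'Hom(subvs_of h, K^o)))%VS.
Proof.
have [[hh _ _] [_ rP _ _] _] := td.
apply/subvP => z hz; apply/root_spaceP => y; rewrite lfunE /= scale0r.
have hy := subvsP y.
apply: roots_separate => [|a Pa]; first exact: hh.
have /andP[_ ra] := rP _ Pa.
have x0 : vpick (root_space a) != 0 by rewrite vpick0.
apply/eqP; have /eqP := root_spaceE (memv_pick (root_space a)) (hh _ _ hy hz).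
have E w : w \in h -> [lie w, vpick (root_space a)] = ev a w *: vpick (root_space a).
  by apply: root_spaceE; apply: memv_pick.
rewrite eq_sym lie_act_lie (E z) // (E (vsval y)) // !linearZ /= (E z) // (E (vsval y)) //.
by rewrite scalerN !scalerA [ev a z * _]mulrC subrr scaler_eq0 (negPf x0) orbF.
Qed.

(** A basis adapted to n_-, [h] and n_+. The field [wb_cartan] is what later yields, in
    [root_space0], that the weight space of 0 is exactly [h]. *)
Record weight_basis N (X : N.-tuple g) (wt : 'I_N -> 'Hom(subvs_of h, K^o)) : Prop :=
  WeightBasis {
  wb_basis : basis_of fullv X;
  wb_root : forall i : 'I_N, X`_i \in root_space (wt i);
  wb_cases : forall i, [\/ wt i = 0, wt i \in P | - wt i \in P];
  wb_cartan : forall i : 'I_N, wt i = 0 -> X`_i \in h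
}.

Lemma exists_weight_basis : exists N (X : N.-tuple g) wt, @weight_basis N X wt.
Proof.
have [_ [_ rP _ _] [full _]] := td.
pose T := ('Hom(subvs_of h, K^o) * g)%type.
pose s : seq T := [seq (- a, x) | a <- P, x <- vbasis (root_space (- a))]
  ++ [seq (0, x) | x <- vbasis h]
  ++ [seq (a, x) | a <- P, x <- vbasis (root_space a)].
pose ok (p : T) := [/\ p.2 \in root_space p.1,
  [\/ p.1 = 0, p.1 \in P | - p.1 \in P] & p.1 = 0 -> p.2 \in h].
have nz a : a \in P -> a != 0 by move=> /rP /andP[].
have sok p : p \in s -> ok p.
  rewrite !mem_cat => /or3P[] /=.
  - case/allpairsPdep => a [x [Pa /vbasis_mem ax ->]]; split=> //=.
      by constructor 3; rewrite opprK.
    by move/eqP; rewrite oppr_eq0 (negPf (nz _ Pa)).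
  - case/mapP => x /vbasis_mem hx ->; split=> //=; last by constructor.
    exact: (subvP cartan_abelian).
  - case/allpairsPdep => a [x [Pa /vbasis_mem ax ->]]; split=> //=.
      by constructor 2.
    by move/eqP; rewrite (negPf (nz _ Pa)).
have sfull : <<map snd s>>%VS = fullv.
  apply/eqP; rewrite eqEsubv subvf -full /=.
  have sub (U : {vspace g}) : {subset vbasis U <= map snd s} -> (U <= <<map snd s>>)%VS.
    by move=> e; rewrite -{1}(span_basis (vbasisP U)); apply: sub_span.
  rewrite !subv_add; apply/andP; split; [apply/andP; split|].
  - apply: sumv_seq_sub => a Pa; apply: sub => x ax; apply/mapP; exists (- a, x) => //.
    rewrite mem_cat; apply/orP; left.
    by apply/allpairsPdep; exists a, x.
  - apply: sub => x hx; apply/mapP; exists (0, x) => //.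
    by rewrite !mem_cat (map_f (pair 0)) ?orbT.
  - apply: sumv_seq_sub => a Pa; apply: sub => x ax; apply/mapP; exists (a, x) => //.
    rewrite !mem_cat; apply/orP; right; apply/orP; right.
    by apply/allpairsPdep; exists a, x.
have [s' [ss fs es]] := free_subseq snd s.
pose wt (i : 'I_(size s')) := (nth 0 s' i).1.
exists (size s'), (map_tuple snd (in_tuple s')), wt.
have okn (i : 'I_(size s')) : ok (nth 0 s' i) by apply/sok/ss/mem_nth.
have En (i : 'I_(size s')) : (map_tuple snd (in_tuple s'))`_i = (nth 0 s' i).2.
  by rewrite /= (nth_map 0).
split=> [|i|i|i]; rewrite ?En; try by have [] := okn i.
by rewrite /basis_of /= es sfull eqxx fs.
Qed.

End Triangular.

(** * Traces on weight spaces *)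

(** The products with both indices in [S] cancel, as in tr(AB) = tr(BA); only the terms that leave
    [S] and come back remain. *)
Lemma trace_boundary (K : comNzRingType) N (A B : 'M[K]_N) (S : pred 'I_N) :
  \sum_(i | S i) (A *m B - B *m A) i i =
  \sum_(i | S i) \sum_(j | ~~ S j) A i j * B j i
  - \sum_(i | S i) \sum_(j | ~~ S j) B i j * A j i.
Proof.
have E (C D : 'M[K]_N) : \sum_(i | S i) (C *m D) i i =
    \sum_(i | S i) \sum_(j | S j) C i j * D j i
    + \sum_(i | S i) \sum_(j | ~~ S j) C i j * D j i.
  by rewrite -big_split; apply: eq_bigr => i _; rewrite mxE (bigID S).
transitivity (\sum_(i | S i) (A *m B) i i - \sum_(i | S i) (B *m A) i i).
  by rewrite -sumrB; apply: eq_bigr => i _; rewrite !mxE.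
rewrite !E; set u := \sum_(i | S i) \sum_(j | S j) B i j * A j i.
suff -> : \sum_(i | S i) \sum_(j | S j) A i j * B j i = u by ring.
by rewrite exchange_big; apply: eq_bigr => i _; apply: eq_bigr => j _; rewrite mulrC.
Qed.

(** * Matrices of ad and the Killing form *)

Section AdMatrix.
Variables (K : fieldType) (g : lieAlgType K) (N : nat) (X : N.-tuple g).
Hypothesis basisX : basis_of fullv X.

(* Matrices act on row vectors, so adm f *m adm e is the matrix of ad e \o ad f. *)
Definition adm (x : g) : 'M[K]_N := \matrix_(i, j) coord X j [lie x, X`_i].
Definition rowv (x : g) : 'rV[K]_N := \row_j coord X j x.
Definition kil (x y : g) : K := \tr (adm x *m adm y).

Lemma coordE x : x = \sum_i coord X i x *: X`_i.
Proof. exact: coord_basis basisX (memvf x). Qed.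

Fact rowv_is_linear : linear rowv.
Proof. by move=> a x y; apply/rowP => j; rewrite !mxE linearP. Qed.
HB.instance Definition _ := GRing.isLinear.Build K g 'rV[K]_N _ rowv rowv_is_linear.

Fact adm_is_linear : linear adm.
Proof.
by move=> a x y; apply/matrixP => i j; rewrite !mxE lieDl lieZl linearP.
Qed.
HB.instance Definition _ := GRing.isLinear.Build K g 'M[K]_N _ adm adm_is_linear.

Lemma coord_inj x : (forall i, coord X i x = 0) -> x = 0.
Proof. by move=> e; rewrite (coordE x) big1 // => i _; rewrite e scale0r. Qed.

Lemma rowv_surj (v : 'rV[K]_N) : rowv (\sum_i v 0 i *: X`_i) = v.
Proof.
apply/rowP => j; rewrite mxE coord_sum_free //; exact: basis_free basisX.
Qed.

Lemma coord_lie x y j : coord X j [lie x, y] = \sum_i coord X i y * adm x i j.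
Proof.
rewrite {1}(coordE y) !linear_sum; apply: eq_bigr => i _ /=.
by rewrite !linearZ /= mxE.
Qed.

Lemma adm_lie x y : adm [lie x, y] = adm y *m adm x - adm x *m adm y.
Proof.
apply/matrixP => i j; rewrite [LHS]mxE lie_act_lie linearB /= !coord_lie !mxE.
by congr (_ - _); apply: eq_bigr => k _; congr (_ * _); rewrite mxE.
Qed.

Lemma kilC x y : kil x y = kil y x. Proof. exact: mxtrace_mulC. Qed.
Fact kil_is_linear x : linear_for *%R (kil x).
Proof. by move=> a y z; rewrite /kil linearP mulmxDr -scalemxAr linearP. Qed.
HB.instance Definition _ x := GRing.isLinear.Build K g K *%R (kil x) (kil_is_linear x).

Lemma kil_inv x y z : kil [lie x, y] z = kil x [lie y, z].
Proof.
rewrite /kil !adm_lie mulmxBl mulmxBr !linearB /=; congr (_ - _).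
  by rewrite -mulmxA mxtrace_mulC mulmxA.
by rewrite -mulmxA.
Qed.

(** By invariance the radical of the form is an ideal; since the form is nonzero this ideal is
    proper, hence 0. *)
Lemma kil_ideal : lie_simple g -> (exists x y, kil x y != 0) ->
  forall x, (forall y, kil x y = 0) -> x = 0.
Proof.
move=> g_simple [u [v uv]].
pose f (x : g) : 'rV[K]_N := \row_j kil X`_j x.
have fl : linear f by move=> a x y; apply/rowP => j; rewrite !mxE linearP.
pose F := linfun (HB.pack f (GRing.isLinear.Build K g 'rV[K]_N _ f fl) : {linear g -> 'rV[K]_N}).
have IP x : reflect (forall y, kil x y = 0) (x \in lker F).
  rewrite memv_ker lfunE /=; apply: (iffP eqP) => [/rowP e y|e].
    rewrite (coordE y) linear_sum big1 // => i _ /=.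
    by rewrite linearZ /= kilC; have := e i; rewrite !mxE => ->; rewrite mulr0.
  by apply/rowP => j; rewrite !mxE kilC.
have I : lie_ideal (lker F).
  move=> x y /IP e; apply/IP => z; rewrite lieC.
  by rewrite -scaleN1r kilC linearZ /= kilC kil_inv e mulr0.
case: (g_simple.2 _ I) => [e0|ef] x /IP; first by rewrite e0 memv0 => /eqP.
have /IP/(_ v)/eqP : u \in lker F by rewrite ef memvf.
by rewrite (negPf uv).
Qed.

End AdMatrix.

Section WeightBasis.
Variables (K : numFieldType) (g : lieAlgType K) (h : {vspace g}).
Local Notation weight := 'Hom(subvs_of h, K^o).
Variable P : seq weight.
Hypotheses (g_simple : lie_simple g) (td : triangular_decomposition P).
Variables (N : nat) (X : N.-tuple g) (wt : 'I_N -> weight).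
Hypothesis wb : weight_basis P X wt.
Implicit Types (a b c : weight) (x y z t : g).

Local Notation adm := (adm X).
Local Notation kil := (kil X).
Local Notation basisX := (wb_basis wb).

Lemma coord_h t x i : t \in h -> coord X i [lie t, x] = ev (wt i) t * coord X i x.
Proof.
move=> ht; rewrite {1}(coordE basisX x) linear_sum /=.
under eq_bigr => j _ do rewrite linearZ /= (root_spaceE (wb_root wb j) ht) scalerA.
by rewrite coord_sum_free ?(basis_free basisX) // mulrC.
Qed.

Lemma coord_wt a x i : x \in root_space a -> coord X i x != 0 -> wt i = a.
Proof.
move=> ax xi; apply: ev_inj => t ht.
have := coord_h x i ht; rewrite (root_spaceE ax ht) linearZ /=.
by move/(mulIf xi).
Qed.

Lemma mem_h_coord x : (forall i, coord X i x != 0 -> wt i = 0) -> x \in h.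
Proof.
move=> e; rewrite (coordE basisX x) memv_suml // => i _.
have [->|/e w0] := eqVneq (coord X i x) 0; first by rewrite scale0r mem0v.
by rewrite memvZ // (wb_cartan wb).
Qed.

Lemma root_space0 : root_space (0%R : weight) = h.
Proof.
apply/eqP; rewrite eqEsubv (cartan_abelian g_simple td) andbT.
by apply/subvP => x x0; apply: mem_h_coord => i; apply: coord_wt.
Qed.

Lemma h_root0 t : t \in h -> t \in root_space (0%R : weight).
Proof. by rewrite root_space0. Qed.

Lemma adm_wt a x i j : x \in root_space a -> adm x i j != 0 -> wt j = wt i + a.
Proof.
move=> ax; rewrite mxE => xij; rewrite addrC.
exact: coord_wt (lie_root_space ax (wb_root wb i)) xij.
Qed.

Lemma adm_h t i j : t \in h -> adm t i j = ev (wt i) t *+ (i == j).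
Proof.
move=> ht; rewrite mxE (root_spaceE (wb_root wb i) ht) linearZ /=.
by rewrite (coord_free _ _ (basis_free basisX)) mulr_natr eq_sym.
Qed.

Lemma kil_orth a b x y : x \in root_space a -> y \in root_space b ->
  a + b != 0 -> kil x y = 0.
Proof.
move=> ax bY ab; apply: big1 => i _; rewrite mxE; apply: big1 => j _.
apply/eqP; apply: contraNT ab; rewrite mulf_eq0 negb_or => /andP[xij yji].
have := adm_wt bY yji; rewrite (adm_wt ax xij) -addrA => /eqP.
by rewrite -subr_eq0 opprD addNKr oppr_eq0.
Qed.

Lemma kil_h s t : s \in h -> t \in h ->
  kil s t = \sum_i ev (wt i) s * ev (wt i) t.
Proof.
move=> hs ht; apply: eq_bigr => i _; rewrite mxE (bigD1 i) //= big1 => [|j ij].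
  by rewrite !adm_h // eqxx addr0.
by rewrite adm_h // eq_sym (negPf ij) mul0r.
Qed.

Lemma lie_opp_root b e f : e \in root_space b -> f \in root_space (- b) ->
  [lie e, f] \in h.
Proof. by move=> be bf; rewrite -root_space0 -(subrr b) lie_root_space. Qed.

(** * Trace identities along strings of weights *)

Section String.
Variables (b : weight) (e f : g).
Hypotheses (be : e \in root_space b) (bf : f \in root_space (- b)).
Local Notation t := [lie e, f].

(* The trace of ad e \o ad f on the weight space of c. *)
Definition efT c : K := \sum_(i | wt i == c) (adm f *m adm e) i i.

Let ht : t \in h. Proof. exact: (lie_opp_root be bf). Qed.

(** The left side is the trace of ad [e, f] over the vectors indexed by [S]. As ad e does not leave
    [S], only one of the two boundary terms of [trace_boundary] survives. *)
Lemma sum_wt_up (S : pred 'I_N) :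
  (forall i j, S i -> wt j = wt i + b -> S j) ->
  \sum_(i | S i) ev (wt i) t =
  \sum_(i | S i) \sum_(j | ~~ S j) adm f i j * adm e j i.
Proof.
move=> up; transitivity (\sum_(i | S i) (adm t) i i).
  by apply: eq_bigr => i _; rewrite adm_h // eqxx.
rewrite (adm_lie basisX) (trace_boundary (adm f) (adm e) S) [X in _ - X]big1 ?subr0 // => i Si.
apply: big1 => j Sj; apply/eqP; apply: contraNT Sj; rewrite mulf_eq0 negb_or.
by case/andP => /(adm_wt be) /(up _ _ Si).
Qed.

Lemma sum_wt_closed (S : pred 'I_N) :
  (forall i j, S i -> wt j = wt i + b -> S j) ->
  (forall i j, S i -> wt j = wt i - b -> S j) ->
  \sum_(i | S i) ev (wt i) t = 0.
Proof.
move=> up dn; rewrite sum_wt_up //; apply: big1 => i Si; apply: big1 => j Sj.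
apply/eqP; apply: contraNT Sj; rewrite mulf_eq0 negb_or.
by case/andP => /(adm_wt bf) /(dn _ _ Si).
Qed.

Lemma sum_wt_string c :
  \sum_(i | `[< exists z : int, wt i = c + b *~ z >]) ev (wt i) t = 0.
Proof.
apply: sum_wt_closed => i j /asboolP[z iE] jE; apply/asboolP.
  by exists (z + 1); rewrite jE iE mulrzDr addrA.
by exists (z - 1); rewrite jE iE mulrzDr addrA mulrN1z.
Qed.

(** The vanishing sum over the whole string reads n c(t) + m b(t) = 0, with n > 0 the number of
    basis vectors in the string and m an integer; so c(t) is a rational multiple of b(t). *)
Lemma string_real c : (exists i, wt i = c) ->
  exists2 q : K, q \is Num.real & ev c t = q * ev b t.
Proof.
case=> i0 wi0.
pose S : pred 'I_N := fun i => `[< exists z : int, wt i = c + b *~ z >].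
have [z zP] : exists z : 'I_N -> int, forall i, S i -> wt i = c + b *~ z i.
  suff /boolp.choice[z zP] : forall i, exists z : int, S i -> wt i = c + b *~ z by exists z.
  move=> i; case: (pselect (S i)) => [/asboolP[z iz]|nS]; first by exists z.
  by exists 0 => /nS.
have := sum_wt_string c; rewrite -/S.
pose n := #|S|; pose m : K := \sum_(i | S i) (z i)%:~R.
have -> : \sum_(i | S i) ev (wt i) t = n%:R * ev c t + m * ev b t.
  rewrite mulr_natl -sumr_const mulr_suml -big_split; apply: eq_bigr => i /zP ->.
  by rewrite evD evMz.
move=> E; have n0 : n%:R != 0 :> K.
  rewrite pnatr_eq0 -lt0n; apply/card_gt0P; exists i0; apply/asboolP.
  by exists 0; rewrite addr0.
exists (- m / n%:R).
  by rewrite rpredM ?rpredN ?rpredV ?realn // rpred_sum // => i _; rewrite realz.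
apply: (mulfI n0); move/eqP: E; rewrite addr_eq0 => /eqP->.
by rewrite mulrA mulrCA divff // mulr1 mulNr.
Qed.

Hypothesis b0 : b != 0.

(** In the half-string c + n b, ad f leaves only from weight c, and there it always does, as c - b
    is outside when b is nonzero. So the boundary term of [sum_wt_up] is the full trace on the
    weight space of c. *)
Lemma efT_up c :
  efT c = \sum_(i | `[< exists n : nat, wt i = c + b *+ n >]) ev (wt i) t.
Proof.
pose S : pred 'I_N := fun i => `[< exists n : nat, wt i = c + b *+ n >].
rewrite (sum_wt_up (S := S)) => [|i j /asboolP[n iE] jE]; last first.
  by apply/asboolP; exists n.+1; rewrite jE iE mulrSr addrA.
rewrite [RHS](bigID (fun i => wt i == c)) /= [X in _ + X]big1 ?addr0 => [|i /andP[Si ic]].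
  have Sc i : wt i = c -> S i by move=> iE; apply/asboolP; exists 0; rewrite iE addr0.
  apply: eq_big => [i|i /eqP ic]; first by case: eqP => [/Sc->|]; rewrite ?andbF.
  rewrite mxE (bigID S) /= big1 ?add0r // => j /asboolP[n jn].
  apply/eqP; apply: contraNT b0; rewrite mulf_eq0 negb_or => /andP[/(adm_wt bf)].
  rewrite jn ic => E _; apply/eqP; apply: ev_inj => s _; rewrite ev0.
  have := congr1 (fun a : weight => ev a s) E; rewrite !evD evMn evN => /addrI/eqP.
  by rewrite -addr_eq0 -{2}[ev b s]mul1r -mulrDl -mulrSr mulf_eq0 pnatr_eq0 => /eqP.
apply: big1 => j Sj; apply/eqP; apply: contraNT Sj; rewrite mulf_eq0 negb_or.
case/andP => /(adm_wt bf) jE _; case/asboolP: Si => -[|n] iE.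
  by rewrite iE addr0 eqxx in ic.
by apply/asboolP; exists n; rewrite jE iE mulrSr addrA addrK.
Qed.

End String.

End WeightBasis.

(** * The Killing form *)

Lemma sumr_wt_seq (V : nmodType) (T : eqType) (I : finType) (s : seq T)
    (w : I -> T) (F : I -> V) : uniq s ->
  \sum_(i | w i \in s) F i = \sum_(c <- s) \sum_(i | w i == c) F i.
Proof.
move=> us; under [RHS]eq_bigr do rewrite big_mkcond /=.
rewrite exchange_big /= big_mkcond; apply: eq_bigr => i _; rewrite -big_mkcond /=.
under eq_bigl do rewrite eq_sym.
case: ifP => si; first by rewrite -big_filter filter_pred1_uniq // big_seq1.
by rewrite big_seq_cond big1 // => c /andP[sc /eqP ci]; rewrite -ci sc in si.
Qed.

Section KillingForm.
Variables (K : numFieldType) (g : lieAlgType K) (h : {vspace g}).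
Local Notation weight := 'Hom(subvs_of h, K^o).
Variable P : seq weight.
Hypotheses (g_simple : lie_simple g) (td : triangular_decomposition P).
Variables (N : nat) (X : N.-tuple g) (wt : 'I_N -> weight).
Hypothesis wb : weight_basis P X wt.
Implicit Types (a b c : weight) (x y z t : g).

Local Notation adm := (adm X).
Local Notation kil := (kil X).
Local Notation basisX := (wb_basis wb).

Lemma basis_neq0 (i : 'I_N) : X`_i != 0.
Proof.
apply: (basis_not0 basisX); apply: mem_nth; rewrite size_tuple; exact: ltn_ord.
Qed.

Lemma root_space_wt a : root_space a != 0%VS -> exists i, wt i = a.
Proof.
rewrite -vpick0 => x0; apply: contrapT => no; case/eqP: x0.
apply: (coord_inj basisX) => i; apply: contrapT => /eqP xi.
by apply: no; exists i; apply: (coord_wt wb (memv_pick _) xi).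
Qed.

Lemma wt_root_space i : root_space (wt i) != 0%VS.
Proof.
apply: contra (basis_neq0 i) => /eqP e; rewrite -memv0 -e; exact: wb_root wb i.
Qed.

Lemma weights_separate t : t \in h -> (forall i, ev (wt i) t = 0) -> t = 0.
Proof.
move=> ht e; apply: (roots_separate g_simple td ht) => a Pa.
have [_ [_ /(_ _ Pa) /andP[_ /root_space_wt[i <-]] _ _] _] := td.
exact: e.
Qed.

(** Each weight has a real ratio q to [b] at [e, f], so the Killing square is b(t)^2 times the sum
    of the q^2; this sum is positive because the weight [b] itself contributes 1. *)
Lemma kil_string b e f : root_space b != 0%VS ->
  e \in root_space b -> f \in root_space (- b) -> ev b [lie e, f] != 0 ->
  exists2 s : K, 0 < s & kil [lie e, f] [lie e, f] = s * ev b [lie e, f] ^+ 2.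
Proof.
move=> /root_space_wt[i1 bi] be bf; set t := [lie e, f] => bt.
have ht : t \in h := lie_opp_root g_simple td wb be bf.
have /boolp.choice[q qP] : forall i, exists q : K, q \is Num.real /\ ev (wt i) t = q * ev b t.
  move=> i; have [|q qr qE] := @string_real _ _ _ _ g_simple td _ _ _ wb b e f be bf (wt i).
    by exists i.
  by exists q.
exists (\sum_i q i ^+ 2); last first.
  rewrite (kil_h wb ht ht) mulr_suml; apply: eq_bigr => i _.
  by have [_ ->] := qP i; rewrite -expr2 exprMn.
have q1 : q i1 = 1.
  by apply: (mulIf bt); rewrite mul1r; have [_ <-] := qP i1; rewrite bi.
rewrite (bigD1 i1) //= q1 expr1n ltr_pwDl ?ltr01 // sumr_ge0 // => i _.
by rewrite real_exprn_even_ge0 //; have [] := qP i.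
Qed.

(* Cartan's criterion: otherwise every [g_b, g_{-b}] is zero and [g, g] has no component in h. *)
Lemma kil_neq0 : exists x y, kil x y != 0.
Proof.
apply: contrapT => no.
have k0 x y : kil x y = 0 by apply: contrapT => /eqP xy; apply: no; exists x, y.
have ef0 b e f : root_space b != 0%VS -> e \in root_space b -> f \in root_space (- b) ->
    [lie e, f] = 0.
  move=> rb be bf; have ht := lie_opp_root g_simple td wb be bf.
  have bt : ev b [lie e, f] = 0.
    apply: contrapT => /eqP bt; have [s s0 /eqP] := kil_string rb be bf bt.
    by rewrite k0 eq_sym mulf_eq0 (gt_eqF s0) expf_eq0 (negPf bt).
  apply: weights_separate => // i; have [|q _ ->] := string_real g_simple td wb be bf (c := wt i).
    by exists i.
  by rewrite bt mulr0.
(* [g, g] = g is spanned by brackets of weight vectors, and those of weight 0 vanish by [ef0]; a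
   coordinate of weight 0 would thus be zero on all of [g]. *)
have no0 k : wt k <> 0.
  move=> k0'; have /eqP := liev_simple g_simple.
  rewrite eqEsubv subvf /= => /subvP/(_ X`_k (memvf _)).
  suff: (liev fullv fullv <= lker (linfun (coord X k : g -> K^o)))%VS.
    move=> /subvP sub /sub; rewrite memv_ker lfunE /= (coord_free _ _ (basis_free basisX)).
    by rewrite eqxx oner_eq0.
  apply/span_subvP => _ /allpairsP[[x y] /= [_ _ ->]].
  rewrite memv_ker lfunE /= (coord_lie basisX) big1 // => i _.
  rewrite {1}(coordE basisX x) linear_sum summxE big1 ?mulr0 // => j _.
  rewrite linearZ mxE; suff -> : adm X`_j i k = 0 by rewrite mulr0.
  apply/eqP; apply: contraT => nz; move: (adm_wt wb (wb_root wb j) nz); rewrite k0' => /esym/eqP.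
  rewrite addr_eq0 => /eqP ij; move: nz; rewrite mxE (ef0 (wt j)) ?linear0 ?eqxx //.
  - exact: wt_root_space.
  - exact: wb_root wb j.
  - by rewrite -ij; apply: wb_root wb i.
(* Once [h] is 0, all weights are the zero form, which [no0] excludes. *)
have h0 t : t \in h -> t = 0.
  move=> ht; apply: (coord_inj basisX) => i; apply: contrapT => /eqP ti.
  exact: no0 (coord_wt wb (h_root0 g_simple td wb ht) ti).
have [[x [y /eqP xy]] _] := g_simple; apply: xy.
apply: (coord_inj basisX) => i; case: (no0 i); apply: ev_inj => t /h0 ->.
by rewrite !linear0.
Qed.

Lemma kil_nondeg x : (forall y, kil x y = 0) -> x = 0.
Proof. exact: (kil_ideal basisX g_simple kil_neq0). Qed.

(** An sl2-triple up to scaling: [t] is normalized as the Killing dual of [b], so b(t) is positive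
    but need not be 2. *)
Record root_triple (b : weight) (e f t : g) : Prop := RootTriple {
  rt_e : e \in root_space b;
  rt_f : f \in root_space (- b);
  rt_t : [lie e, f] = t;
  rt_h : t \in h;
  rt_kil : forall s, s \in h -> kil t s = ev b s;
  rt_gt0 : 0 < ev b t;
  rt_real : forall i, ev (wt i) t \is Num.real
}.

(** Nondegeneracy gives [f] with kappa(e, f) = 1, and invariance makes t = [e, f] dual to [b]. If
    b(t) were 0, all weights would vanish at t, so t = 0 and b = 0. Finally b(t) = kappa(t, t) = s
    b(t)^2 with s > 0, whence b(t) > 0. *)
Lemma exists_root_triple b : b != 0 -> root_space b != 0%VS ->
  exists e f t, root_triple b e f t.
Proof.
move=> b0 rb; pose e := vpick (root_space b).
have be : e \in root_space b := memv_pick _.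
have e0 : e != 0 by rewrite vpick0.
have [i ei] : exists i : 'I_N, kil e X`_i != 0.
  apply: contrapT => no; case/eqP: e0; apply: kil_nondeg => y.
  rewrite (coordE basisX y) linear_sum big1 // => i _ /=; rewrite linearZ /=.
  suff -> : kil e X`_i = 0 by rewrite mulr0.
  by apply: contrapT => /eqP ei; apply: no; exists i.
have bi : wt i = - b.
  apply/eqP; rewrite -addr_eq0 addrC; apply: contraNT ei => bi.
  by rewrite (kil_orth wb be (wb_root wb i) bi).
pose f := (kil e X`_i)^-1 *: X`_i.
have bf : f \in root_space (- b) by rewrite -bi memvZ // (wb_root wb).
have ef : kil e f = 1 by rewrite linearZ /= mulVf.
have ht := lie_opp_root g_simple td wb be bf.
have kt s : s \in h -> kil [lie e, f] s = ev b s.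
  move=> hs; rewrite (kil_inv basisX) lieC (root_spaceE bf hs) evN scaleNr opprK.
  by rewrite linearZ /= ef mulr1.
have real i' : exists2 q : K, q \is Num.real & ev (wt i') [lie e, f] = q * ev b [lie e, f].
  by apply: (string_real g_simple td wb be bf); exists i'.
have bt : ev b [lie e, f] != 0.
  apply: contra b0 => /eqP bt.
  have t0 : [lie e, f] = 0.
    by apply: weights_separate => // i'; have [q _ ->] := real i'; rewrite bt mulr0.
  apply/eqP/ev_inj => s hs; rewrite ev0 -kt // t0 kilC; exact: linear0.
have bt0 : 0 < ev b [lie e, f].
  have [s s0] := kil_string rb be bf bt; rewrite kt // expr2 mulrA => E.
  have : s * ev b [lie e, f] = 1 by apply: (mulIf bt); rewrite mul1r -E.
  by move=> E1; rewrite -(pmulr_rgt0 _ s0) E1 ltr01.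
exists e, f, [lie e, f]; split=> // i'; have [q qr ->] := real i'.
by rewrite rpredM // gtr0_real.
Qed.

(** * Positivity of traces on strings *)

Section Triple.
Variables (b : weight) (e f t : g).
Hypothesis rt : root_triple b e f t.
Let be := rt_e rt.
Let bf := rt_f rt.

Lemma rt_neq0 : b != 0.
Proof. by apply: contraTneq (rt_gt0 rt) => ->; rewrite ev0 ltxx. Qed.

Lemma efT_rt c : efT X wt e f c =
  \sum_(i | `[< exists n : nat, wt i = c + b *+ n >]) ev (wt i) t.
Proof. by rewrite (efT_up g_simple td wb be bf rt_neq0) (rt_t rt). Qed.

Lemma efT_gt0 c : (exists i, wt i = c) -> 0 < ev c t -> 0 < efT X wt e f c.
Proof.
case=> i0 i0c ct; rewrite efT_rt (bigD1 i0) /=; last first.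
  by apply/asboolP; exists 0; rewrite addr0.
rewrite i0c ltr_pwDl // sumr_ge0 // => i /andP[/asboolP[n ->] _].
by rewrite evD evMn addr_ge0 ?(ltW ct) // mulr_ge0 ?ler0n // ltW // (rt_gt0 rt).
Qed.

(* When c(t) < 0 the part of the string below c has negative sum and the whole string has sum 0. *)
Lemma efT_ge0 c : 0 <= efT X wt e f c.
Proof.
case: (pselect (exists i, wt i = c)) => [[i0 i0c]|no]; last first.
  by rewrite /efT big_pred0 // => i; apply/eqP => ic; apply: no; exists i.
have cr : ev c t \is Num.real by rewrite -i0c (rt_real rt).
have b0 := rt_gt0 rt.
rewrite efT_rt; case: (real_ge0P cr) => ct.
  apply: sumr_ge0 => i /asboolP[n ->].
  by rewrite evD evMn addr_ge0 // mulr_ge0 ?ler0n // ltW.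
have := sum_wt_string g_simple td wb be bf c; rewrite (rt_t rt).
set S := (X in \sum_(i | X i) _ = 0).
rewrite (bigID (fun i => `[< exists n : nat, wt i = c + b *+ n >])) /=.
rewrite (eq_bigl (fun i => `[< exists n : nat, wt i = c + b *+ n >])); last first.
  move=> i; apply/andP/idP => [[]//|Ui]; split=> //.
  by case/asboolP: Ui => n iE; apply/asboolP; exists n.
move/eqP; rewrite addr_eq0 => /eqP ->; rewrite oppr_ge0.
apply: sumr_le0 => i /andP[/asboolP[[n|n] iE] /asboolP nU].
  by case: nU; exists n.
rewrite iE evD evMz -[leRHS]addr0 lerD ?(ltW ct) // mulr_le0_ge0 ?(ltW b0) //.
by rewrite NegzE mulrNz oppr_le0 ler0n.
Qed.

(** This is (2 rho, b) > 0, roots being counted with multiplicity. The set [P] is stable under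
    adding [b], so [sum_wt_up] applies; the resulting boundary term, sorted by weight c, is 0 if c -
    b is positive and the nonnegative [efT] of c otherwise. The weight c = b falls in the second
    case and contributes strictly. *)
Lemma rho_gt0 : b \in P -> 0 < \sum_(i | wt i \in P) ev (wt i) t.
Proof.
have [_ [uP rP dP aP] _] := td => Pb.
have nP c : c \in P -> - c \notin P by move=> Pc; have := dP _ (rP _ Pc); rewrite Pc; case: (_ \in P).
have P0 : 0%R \notin P by apply/negP => /rP /andP[/eqP].
rewrite -(rt_t rt) (sum_wt_up g_simple td wb be bf (S := fun i => wt i \in P)); last first.
  move=> i j Pi jE; rewrite jE; apply: aP => //; rewrite /is_root -jE wt_root_space andbT.
  rewrite jE; apply/eqP => /eqP; rewrite addr_eq0 => /eqP iE.
  by have := nP _ Pb; rewrite -iE Pi.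
pose F i := \sum_(j | wt j \notin P) adm f i j * adm e j i.
have FE c : \sum_(i | wt i == c) F i = if c - b \in P then 0 else efT X wt e f c.
  case: ifP => cb.
    apply: big1 => i /eqP ic; apply: big1 => j; apply: contraNeq.
    by rewrite mulf_eq0 negb_or => /andP[/(adm_wt wb bf) -> _]; rewrite ic.
  apply: eq_bigr => i /eqP ic; rewrite mxE [RHS](bigID (fun j => wt j \in P)) /=.
  rewrite big1 ?add0r // => j Pj; apply/eqP; move: Pj; apply: contraLR.
  by rewrite mulf_eq0 negb_or => /andP[/(adm_wt wb bf) -> _]; rewrite ic cb.
rewrite (sumr_wt_seq wt F uP) (big_rem _ Pb) /= FE subrr (negPf P0).
rewrite ltr_pwDl ?sumr_ge0 // => [|c _]; last by rewrite FE; case: ifP => // _; apply: efT_ge0.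
by apply: efT_gt0; [apply: root_space_wt; case/andP: (rP _ Pb) | exact: (rt_gt0 rt)].
Qed.

(* Otherwise f kills g_c, hence the trace of e f on g_c is zero. *)
Lemma sub_root_space c : root_space c != 0%VS -> 0 < ev c t -> root_space (c - b) != 0%VS.
Proof.
move=> /root_space_wt rc ct; have := efT_gt0 rc ct; apply: contraTneq => cb.
suff -> : efT X wt e f c = 0 by rewrite ltxx.
apply: big1 => i /eqP ic; rewrite mxE big1 // => j _; apply/eqP.
apply: contraT; rewrite mulf_eq0 negb_or => /andP[/(adm_wt wb bf) jE _].
by have := wt_root_space j; rewrite jE ic cb eqxx.
Qed.
End Triple.

(** [H] is the Killing dual of 2 rho: by symmetry of the form, b(H) is the sum of the values of the
    positive roots at the dual of [b]. *)
Lemma exists_height :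
  exists2 H, H \in h & forall b, b \in P -> 0 < ev b H.
Proof.
have [_ [_ rP _ _] _] := td.
have /boolp.choice[tt ttP] : forall b, exists t, b \in P -> exists e f, root_triple b e f t.
  move=> b; case: (boolP (b \in P)) => [/rP/andP[b0 rb]|_]; last by exists 0.
  by have [e [f [t rt]]] := exists_root_triple b0 rb; exists t; exists e, f.
have hH : \sum_(i | wt i \in P) tt (wt i) \in h.
  by apply: memv_suml => i /ttP[e [f rt]]; apply: rt_h rt.
exists (\sum_(i | wt i \in P) tt (wt i)) => // b Pb.
have [e [f rt]] := ttP _ Pb.
rewrite -(rt_kil rt) // linear_sum /=.
suff -> : \sum_(i | wt i \in P) kil (tt b) (tt (wt i)) = \sum_(i | wt i \in P) ev (wt i) (tt b).
  exact: (rho_gt0 rt).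
apply: eq_bigr => i /ttP[e' [f' rt']].
by rewrite kilC (rt_kil rt') ?(rt_h rt).
Qed.

End KillingForm.

(** * Simple roots and the principal nilpotent *)

(* If C x = 0 and |x_i| / y_i is maximal, row i bounds this maximum by 0. *)
Lemma dominant_unitmx (K : numFieldType) m (C : 'M[K]_m) (y : 'I_m -> K) :
  (forall i j, i != j -> C i j <= 0) -> (forall i, 0 <= y i) ->
  (forall i, 0 < \sum_j C i j * y j) -> C \in unitmx.
Proof.
move=> C0 y0 Cy.
have off i (z : 'I_m -> K) : (forall j, 0 <= z j) -> \sum_(j | j != i) C i j * z j <= 0.
  by move=> z0; apply: sumr_le0 => j ij; rewrite mulr_le0_ge0 // C0 // eq_sym.
have dia i : 0 < C i i * y i.
  apply: lt_le_trans (Cy i) _; rewrite (bigD1 i) //= -[leRHS]addr0 lerD2l; exact: off.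
have yp i : 0 < y i.
  by rewrite lt_def y0 andbT; apply: contraTneq (dia i) => ->; rewrite mulr0 ltxx.
have Cp i : 0 < C i i by rewrite -(pmulr_lgt0 _ (yp i)).
rewrite -unitmx_tr -row_free_unit; apply: inj_row_free => v /rowP vC.
have E i : \sum_j C i j * v 0 j = 0.
  have := vC i; rewrite !mxE => {2}<-; apply: eq_bigr => j _.
  by rewrite mxE mulrC.
pose r i := `|v 0 i| / y i.
have rr i : r i \is Num.real by rewrite rpredM ?rpredV ?ger0_real // ltW.
apply/rowP => i1; rewrite mxE.
have [i _ imax] := real_arg_maxP (erefl : xpredT i1) (fun i _ => rr i).
have r0 : 0 <= r i by rewrite divr_ge0 ?normr_ge0 // ltW.
have bnd j : `|v 0 j| <= r i * y j.
  by rewrite -ler_pdivrMr //; apply: imax.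
have vi : `|v 0 i| = r i * y i by rewrite /r divfK // gt_eqF.
have : r i * \sum_j C i j * y j <= 0.
  rewrite (bigD1 i) //= mulrDr mulrCA -vi -[leRHS](subrr (C i i * `|v 0 i|)) lerD2l.
  rewrite lerNr mulr_sumr -sumrN.
  have -> : C i i * `|v 0 i| = `|\sum_(j | j != i) C i j * v 0 j|.
    have := E i; rewrite (bigD1 i) //= => /eqP; rewrite addr_eq0 => /eqP Ei.
    by rewrite -[RHS]normrN -Ei normrM gtr0_norm.
  apply: le_trans (ler_norm_sum _ _ _) _; apply: ler_sum => j ij.
  have Cij : C i j <= 0 by rewrite C0 // eq_sym.
  by rewrite normrM (ler0_norm Cij) mulrCA -mulNr ler_wpM2l ?oppr_ge0.
rewrite pmulr_lle0 // => r_le0; have {}r0 : r i = 0 by apply/eqP; rewrite eq_le r_le0.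
by apply/eqP; rewrite -normr_le0 (le_trans (bnd i1)) // r0 mul0r.
Qed.

Lemma perm_basis_card (K : fieldType) (V : vectType K) N (X : N.-tuple V)
    (S : pred 'I_N) (U : {vspace V}) :
  basis_of fullv X -> (forall i, S i -> X`_i \in U) ->
  (forall x i, x \in U -> coord X i x != 0 -> S i) -> \dim U = #|S|.
Proof.
move=> bX SU US; pose Y := [seq X`_i | i : 'I_N <- enum S].
have XE : [seq X`_i | i : 'I_N <- enum 'I_N] = X.
  apply: (@eq_from_nth _ 0); first by rewrite size_map size_enum_ord size_tuple.
  move=> i; rewrite size_map size_enum_ord => lti.
  by rewrite (nth_map (Ordinal lti)) ?size_enum_ord // nth_enum_ord.
have enumS (A : pred 'I_N) : enum A = filter A (enum 'I_N) by rewrite enumT.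
have : free Y.
  have pX : perm_eq (Y ++ [seq X`_i | i : 'I_N <- enum (predC S)]) X.
    rewrite -{2}XE -map_cat; apply: perm_map; rewrite [enum S]enumS [enum (predC S)]enumS.
    by rewrite perm_filterC.
  by apply: (@catl_free _ _ [seq X`_i | i : 'I_N <- enum (predC S)]); rewrite (perm_free pX) (basis_free bX).
move=> fY; have /eqP -> : U == <<Y>>%VS; last by move: fY; rewrite /free => /eqP ->; rewrite size_map -cardE.
rewrite eqEsubv; apply/andP; split; last first.
  by apply/span_subvP => _ /mapP[i + ->]; rewrite mem_enum => /SU.
apply/subvP => x Ux; rewrite (coord_basis bX (memvf x)) memv_suml // => i _.
have [->|/(US _ _ Ux) Si] := eqVneq (coord X i x) 0; first by rewrite scale0r mem0v.
rewrite memvZ // memv_span //; apply/mapP; exists i => //; by rewrite mem_enum.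
Qed.

Section SimpleRoots.
Variables (K : numFieldType) (g : lieAlgType K) (h : {vspace g}).
Local Notation weight := 'Hom(subvs_of h, K^o).
Variable P : seq weight.
Hypotheses (g_simple : lie_simple g) (td : triangular_decomposition P).
Variables (N : nat) (X : N.-tuple g) (wt : 'I_N -> weight).
Hypothesis wb : weight_basis P X wt.
Implicit Types (a b c : weight) (x y z t : g).

Local Notation adm := (adm X).
Local Notation kil := (kil X).
Local Notation basisX := (wb_basis wb).

Definition simple_roots := [seq a <- P | all (fun b => a - b \notin P) P].
Local Notation D := simple_roots.

Lemma simpleP a : reflect (a \in P /\ forall b, b \in P -> a - b \notin P) (a \in D).
Proof.
rewrite mem_filter andbC; apply: (iffP andP) => -[Pa].
  by move=> /allP e; split=> // b /e.
by move=> e; split=> //; apply/allP.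
Qed.

(** A positive root that is not simple is a sum of two positive roots with smaller values at [H].
    These values need not be integers, so the induction is on the number [ht] of positive roots with
    a smaller value. *)
Lemma simple_ind (Q : weight -> Prop) :
  (forall a, a \in D -> Q a) ->
  (forall a b, Q a -> Q b -> Q (a + b)) ->
  forall a, a \in P -> Q a.
Proof.
move=> QD QA; have [H hH Hpos] := exists_height g_simple td wb.
pose ht a := count (fun b => ev b H < ev a H) P.
have dec a b : b \in P -> ev b H < ev a H -> (ht b < ht a)%N.
  move=> Pb ba; have := count_predUI (fun c => ev c H < ev b H) (pred1 b) P.
  rewrite [X in (_ + X)%N](@eq_count _ _ pred0) ?count_pred0 ?addn0; last first.
    by move=> c /=; apply/negP => /andP[+ /eqP cb]; rewrite cb ltxx.
  have : (0 < count_mem b P)%N by rewrite -has_count has_pred1.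
  move=> pos E; apply: leq_trans (_ : (ht b + count_mem b P <= _)%N).
    by rewrite -addn1 leq_add2l.
  rewrite -E; apply: sub_count => c /= /orP[cb|/eqP->//]; exact: lt_trans cb ba.
move=> a; have [n] := ubnP (ht a); elim: n a => // n IHn a lt_a Pa.
case: (boolP (a \in D)) => [/QD //|]; rewrite mem_filter Pa andbT.
case/allPn => b Pb; rewrite negbK => Pab.
rewrite -(subrK b a); apply: QA; apply: IHn => //.
  by apply: leq_trans (dec _ _ Pab _) lt_a; rewrite evB gtrBl Hpos.
by apply: leq_trans (dec _ _ Pb _) lt_a; rewrite -subr_gt0 -evB Hpos.
Qed.

Local Notation m := (size D).
Local Notation sr i := (D`_(nat_of_ord i)).

Lemma simple_comb a : a \in P ->
  exists2 y : 'I_m -> K, forall j, 0 <= y j & forall s, ev a s = \sum_j y j * ev (sr j) s.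
Proof.
move: a; apply: simple_ind => [a Da|a b [y y0 yE] [z z0 zE]].
  exists (fun j => (sr j == a)%:R) => [j|s]; first exact: ler0n.
  have ia : (index a D < m)%N by rewrite index_mem.
  rewrite (bigD1 (Ordinal ia)) //= nth_index // eqxx mul1r big1 ?addr0 // => j ij.
  case: eqP => [ja|]; last by rewrite mul0r.
  case/eqP: ij; apply: val_inj => /=; rewrite -ja index_uniq // filter_uniq //.
  by have [_ [uP _ _ _] _] := td.
exists (fun j => y j + z j) => [j|s]; first by rewrite addr_ge0.
by rewrite evD yE zE -big_split; apply: eq_bigr => j _; rewrite mulrDl.
Qed.

Lemma P_root a : a \in P -> a != 0 /\ root_space a != 0%VS.
Proof. by have [_ [_ rP _ _] _] := td; move=> /rP /andP. Qed.

Lemma P_opp a : a \in P -> - a \notin P.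
Proof.
have [_ [_ rP dP _] _] := td => Pa.
by have := dP _ (rP _ Pa); rewrite Pa; case: (_ \in P).
Qed.

Lemma P_0 : 0%R \notin P.
Proof. by apply/negP => /P_root[/eqP]. Qed.

Lemma root_P a : a != 0 -> root_space a != 0%VS -> a \in P \/ - a \in P.
Proof.
have [_ [_ rP dP _] _] := td => a0 ra.
have := dP a; rewrite /is_root a0 ra => /(_ isT).
by case: (a \in P); [left | rewrite addFb; right].
Qed.

(** The sum of the simple root vectors is completed to a principal sl2-triple. What has to be solved
    is a(H) = 2 for all simple roots a, with [H] a combination of their duals; this requires the
    matrix [C] of their pairings to be invertible. *)
Lemma exists_principal : exists e f H,
  [/\ H \in h, [lie e, f] = H, [lie H, e] = 2%:R *: e, [lie H, f] = - 2%:R *: f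
    & forall a, a \in P -> 0 < ev a H] /\
  [/\ forall i j, adm e i j != 0 -> exists2 a, a \in D & wt j = wt i + a
    & forall j : 'I_N, kil e X`_j != 0 -> - wt j \in P].
Proof.
have srD (i : 'I_m) : sr i \in D by apply: mem_nth.
have srP (i : 'I_m) : sr i \in P by have /simpleP[] := srD i.
have uD : uniq D by have [_ [uP _ _ _] _] := td; apply: filter_uniq.
have /boolp.choice[E /boolp.choice[F /boolp.choice[T ET]]] :
    forall i : 'I_m, exists e f t, root_triple X wt (sr i) e f t.
  by move=> i; have [a0 ra] := P_root (srP i); apply: (exists_root_triple g_simple td wb a0 ra).
(* If a difference of two simple roots were a root, it or its opposite would be positive and would
   decompose one of the two. *)
have diff (i j : 'I_m) : i != j -> root_space (sr j - sr i) = 0%VS.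
  move=> ij; apply/eqP; apply: contraT => r.
  have n0 : sr j - sr i != 0.
    by rewrite subr_eq0 (nth_uniq 0 (ltn_ord j) (ltn_ord i) uD) eq_sym.
  have /simpleP[Pi si] := srD i; have /simpleP[Pj sj] := srD j.
  case: (root_P n0 r); rewrite ?opprB => in_P.
    by have := sj _ Pi; rewrite in_P.
  by have := si _ Pj; rewrite in_P.
pose C : 'M[K]_m := \matrix_(i, j) ev (sr j) (T i).
have Cu : C \in unitmx.
  have /boolp.choice[y yE] : forall i : 'I_N, exists y : 'I_m -> K, wt i \in P ->
      (forall j, 0 <= y j) /\ forall s, ev (wt i) s = \sum_j y j * ev (sr j) s.
    move=> i; case: (boolP (wt i \in P)) => [/simple_comb[y y0 yE]|_]; last by exists (fun=> 0).
    by exists y.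
  (* The vector [y] consists of the coordinates of 2 rho on the simple roots. Off-diagonal entries
     of [C] are not positive by [sub_root_space] and [diff], and [C] times [y] is positive by
     [rho_gt0]. *)
  apply: (@dominant_unitmx _ _ C (fun j => \sum_(i | wt i \in P) y i j)) => [i j ij|j|i].
  - have [i' i'j] := root_space_wt wb (P_root (srP j)).2.
    have := rt_real (ET i) i'; rewrite !mxE -i'j => re.
    case: (real_leP re (real0 _)) => // pos.
    have := sub_root_space g_simple td wb (ET i) (wt_root_space wb i') pos.
    by rewrite i'j diff ?eqxx.
  - by apply: sumr_ge0 => i /yE[].
  - apply: lt_le_trans (rho_gt0 g_simple td wb (ET i) (srP i)) _.
    rewrite le_eqVlt; apply/orP; left; apply/eqP.
    under [RHS]eq_bigr do rewrite mulr_sumr.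
    rewrite exchange_big; apply: eq_bigr => k /yE[_ ->]; apply: eq_bigr => j _.
    by rewrite mxE mulrC.
(* The coefficients for which every simple root takes the value 2 at [H]. *)
pose c := (const_mx 2%:R : 'rV[K]_m) *m invmx C.
pose e := \sum_i E i; pose f := \sum_i c 0 i *: F i; pose H := \sum_i c 0 i *: T i.
have hH : H \in h by apply: memv_suml => i _; rewrite memvZ // (rt_h (ET i)).
have srH (j : 'I_m) : ev (sr j) H = 2%:R.
  have : (c *m C) 0 j = 2%:R by rewrite /c mulmxKV // mxE.
  move=> <-; rewrite linear_sum mxE; apply: eq_bigr => i _ /=.
  by rewrite linearZ /= [C i j]mxE.
exists e, f, H; split; split=> //.
- rewrite /e /f linear_sum; apply: eq_bigr => j _ /=; rewrite linearZ /=; congr (_ *: _).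
  rewrite lieC linear_sum (bigD1 j) //= big1 ?addr0 => [|i ij].
    by rewrite -lieC (rt_t (ET j)).
  apply/eqP; rewrite lieC oppr_eq0 -memv0 -(diff j i) 1?eq_sym //.
  exact: lie_root_space (rt_e (ET i)) (rt_f (ET j)).
- rewrite /e linear_sum scaler_sumr; apply: eq_bigr => i _ /=.
  by rewrite (root_spaceE (rt_e (ET i)) hH) srH.
- rewrite /f linear_sum scaler_sumr; apply: eq_bigr => i _ /=; rewrite linearZ /=.
  by rewrite (root_spaceE (rt_f (ET i)) hH) evN srH !scalerA mulrC.
- move=> a Pa; have [y y0 yE] := simple_comb Pa.
  have aH : ev a H = 2%:R * \sum_j y j.
    by rewrite yE mulr_sumr; apply: eq_bigr => j _; rewrite srH mulrC.
  rewrite aH pmulr_rgt0 ?ltr0n // lt_def sumr_ge0 // andbT.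
  apply: contraNneq (P_root Pa).1 => /eqP; rewrite psumr_eq0 // => /allP y0'.
  apply/eqP/ev_inj => s _; rewrite ev0 yE big1 // => j _.
  by have /eqP -> := y0' j (mem_index_enum j); rewrite mul0r.
- move=> i j; rewrite /e linear_sum summxE => nz.
  have [k nk] := sum_neq0_exists nz.
  by exists (sr k) => //; apply: (adm_wt wb (rt_e (ET k)) nk).
- move=> j; rewrite kilC linear_sum /= => nz.
  have [k nk] := sum_neq0_exists nz.
  suff /eqP -> : - wt j == sr k by [].
  rewrite eq_sym -addr_eq0 addrC; apply: contraNT nk => jk.
  by rewrite (kil_orth wb (wb_root wb j) (rt_e (ET k)) jk).
Qed.

(* The eigenvalues l - 2k of f^k v would be pairwise distinct. *)
Lemma no_negative_highest_weight e f H v (l : K) :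
  H \in h -> [lie e, f] = H -> [lie H, f] = - 2%:R *: f ->
  v != 0 -> [lie H, v] = l *: v -> [lie e, v] = 0 -> ~ l < 0.
Proof.
move=> hH ef Hf v0 Hv ev0 l0.
pose u k := iter k (lieb f) v.
have Hu k : [lie H, u k] = (l - 2%:R * k%:R) *: u k.
  elim: k => [|k IH]; first by rewrite mulr0 subr0.
  rewrite /u iterS -/(u k) -[LHS](subrK [lie f, [lie H, u k]]) -lie_act_lie Hf lieZl IH linearZ /=.
  by rewrite -scalerDl -natr1; congr (_ *: _); ring.
(* From e f u = H u + f e u, each step adds one more negative eigenvalue of [H] to the coefficient,
   so it stays negative and no [u k] vanishes. *)
have eu k : exists2 c : K, c < 0 & [lie e, u k.+1] = c *: u k.
  elim: k => [|k [c c0 IH]].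
    exists l => //; rewrite /u /= -[LHS](subrK [lie f, [lie e, v]]) -lie_act_lie ef Hv.
    by rewrite ev0 linear0 addr0.
  exists (l - 2%:R * k.+1%:R + c).
    rewrite -[ltRHS]addr0 ltrD // subr_lt0; apply: lt_le_trans l0 _.
    by rewrite mulr_ge0 ?ler0n.
  rewrite /u iterS -/(u k.+1) -[LHS](subrK [lie f, [lie e, u k.+1]]) -lie_act_lie ef Hu IH.
  by rewrite linearZ [RHS]scalerDl.
have un k : u k != 0.
  elim: k => // k IH; apply: contra_neq IH => uk; have [c c0] := eu k.
  rewrite uk linear0 => /esym/eqP; rewrite scaler_eq0 => /orP[/eqP c0'|/eqP//].
  by rewrite c0' ltxx in c0.
have /boolp.choice[i iP] : forall k, exists i, ev (wt i) H = l - 2%:R * k%:R.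
  move=> k; apply: contrapT => no; case/eqP: (un k); apply: (coord_inj basisX) => i.
  apply: contrapT => /eqP ui; apply: no; exists i.
  by have := coord_h wb (u k) i hH; rewrite Hu linearZ /= => /(mulIf ui).
(* N + 1 distinct eigenvalues would come from only N weights. *)
have inj : injective (fun k : 'I_N.+1 => i k).
  move=> k k' E; apply: val_inj; have := iP k; rewrite E iP => /addrI/oppr_inj.
  have two0 : 2%:R != 0 :> K by rewrite pnatr_eq0.
  by move/(mulfI two0)/eqP; rewrite eqr_nat => /eqP.
by have := leq_card _ inj; rewrite !card_ord ltnn.
Qed.

(** Take the principal [e] and [w] in n_-. The hypothesis and invariance make [e, w] orthogonal to
    b; ad e adds a simple root, so [e, w] has no part in n_+ and is orthogonal to n_- too. Hence
    [e, w] = 0, and sl2 theory forbids vectors of negative [H]-weight killed by [e]. *)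
Lemma exists_regular_nilpotent : exists2 e : g,
  forall j : 'I_N, - wt j \notin P -> kil e X`_j = 0
  & forall w, (forall i, coord X i w != 0 -> - wt i \in P) ->
      (forall i : 'I_N, - wt i \notin P -> kil e [lie X`_i, w] = 0) -> w = 0.
Proof.
have [e [f [H [[hH ef He Hf Hpos] [eD kP]]]]] := exists_principal.
exists e => [j|w ws wk]; first by apply: contraNeq => /kP.
have ew : [lie e, w] = 0.
  have supp k : coord X k [lie e, w] != 0 -> wt k \notin P.
    rewrite (coord_lie basisX) => nz; have [i ni] := sum_neq0_exists nz; move: ni.
    rewrite mulf_eq0 negb_or => /andP[/ws Pi /eD[a /simpleP[_ sa] ->]].
    by rewrite addrC -[wt i]opprK; apply: sa.
  apply: (kil_nondeg g_simple td wb) => y; rewrite (coordE basisX y) linear_sum big1 // => i _ /=.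
  rewrite linearZ /=; suff -> : kil [lie e, w] X`_i = 0 by rewrite mulr0.
  case: (boolP (- wt i \in P)) => Pi; last first.
    by rewrite (kil_inv basisX) lieC linearN /= wk // oppr0.
  rewrite kilC (coordE basisX [lie e, w]) linear_sum big1 // => k _ /=; rewrite linearZ /=.
  have [->|/supp nP] := eqVneq (coord X k [lie e, w]) 0; first by rewrite mul0r.
  rewrite (kil_orth wb (wb_root wb i) (wb_root wb k)) ?mulr0 //.
  by apply: contraNneq nP => /eqP; rewrite addrC addr_eq0 => /eqP ->.
apply: (coord_inj basisX) => i0; apply: contrapT => /eqP w0.
pose l := ev (wt i0) H.
have l0 : l < 0 by have := Hpos _ (ws _ w0); rewrite evN oppr_gt0.
(* The component of [w] for the eigenvalue [l] of ad H. *)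
pose v := \sum_(i | ev (wt i) H == l) coord X i w *: X`_i.
have vE k : coord X k v = if ev (wt k) H == l then coord X k w else 0.
  rewrite linear_sum /=.
  under eq_bigr do rewrite linearZ /= (coord_free _ _ (basis_free basisX)).
  case: ifP => kl; last first.
    apply: big1 => i il; case: eqP => [ki|]; last by rewrite mulr0.
    by rewrite -ki il in kl.
  rewrite (bigD1 k) //= eqxx mulr1 big1 ?addr0 // => i /andP[_ ik].
  by rewrite (negPf ik) mulr0.
apply: (@no_negative_highest_weight e f H v l hH ef Hf) => //.
- by apply: contra_neq w0 => v0; have := vE i0; rewrite v0 linear0 eqxx.
- rewrite /v linear_sum scaler_sumr; apply: eq_bigr => i /eqP il; rewrite linearZ /=.
  by rewrite (root_spaceE (wb_root wb i) hH) il !scalerA mulrC.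
have step i k : adm e i k != 0 -> ev (wt k) H = 2%:R + ev (wt i) H.
  move=> nz; have := coord_h wb [lie e, X`_i] k hH.
  rewrite -[[lie H, _]](subrK [lie e, [lie H, X`_i]]) -lie_act_lie He lieZl.
  rewrite (root_spaceE (wb_root wb i) hH) linearZ /= -scalerDl linearZ /=.
  by rewrite mxE in nz; move/(mulIf nz).
apply: (coord_inj basisX) => k; rewrite (coord_lie basisX).
(* As ad e raises eigenvalues of ad H by 2, [e, v] is the component of [e, w] = 0 for the eigenvalue
   l + 2. *)
have [kl|kl] := eqVneq (ev (wt k) H) (2%:R + l).
  have E := coord_lie basisX e w k; rewrite ew linear0 in E; rewrite [RHS]E; apply: eq_bigr => i _.
  have [->|/step] := eqVneq (adm e i k) 0; first by rewrite !mulr0.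
  by rewrite kl vE => /addrI <-; rewrite eqxx.
apply: big1 => i _; have [->|/step ik] := eqVneq (adm e i k) 0; first by rewrite mulr0.
rewrite vE; case: eqP => [il|]; last by rewrite mul0r.
by rewrite ik il eqxx in kl.
Qed.

(** The Killing form pairs a root space only with the opposite one, so nondegeneracy embeds n_+ in
    the dual of n_-. *)
Lemma card_pos_le_neg : (#|[pred i | wt i \in P]| <= #|[pred i | (- wt i)%R \in P]|)%N.
Proof.
pose A := [pred i | wt i \in P]; pose B := [pred i | - wt i \in P].
pose G : 'M[K]_(#|A|, #|B|) :=
  \matrix_(i, j) kil X`_(@enum_val _ A i) X`_(@enum_val _ B j).
suff /eqP <- : row_free G by apply: rank_leq_col.
apply: inj_row_free => v /rowP vG.
pose y := \sum_i v 0 i *: X`_(@enum_val _ A i).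
have y0 : y = 0.
  apply: (kil_nondeg g_simple td wb) => z; rewrite (coordE basisX z) linear_sum big1 // => j _ /=.
  rewrite linearZ /= kilC linear_sum /=.
  case: (boolP (j \in B)) => [Bj|Bj].
    have := vG (enum_rank_in Bj j); rewrite !mxE => E.
    rewrite [X in _ * X](_ : _ = 0) ?mulr0 // -[RHS]E; apply: eq_bigr => i _.
    by rewrite linearZ /= !mxE enum_rankK_in // kilC.
  rewrite big1 ?mulr0 // => i _; rewrite linearZ /=.
  rewrite (kil_orth wb (wb_root wb j) (wb_root wb (@enum_val _ A i))) ?mulr0 //.
  apply: contra Bj; rewrite addrC addr_eq0 inE => /eqP <-; exact: (@enum_valP _ A i).
apply/rowP => k; rewrite mxE; have := congr1 (coord X (@enum_val _ A k)) y0.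
rewrite linear0 linear_sum /= => E; rewrite -[RHS]E (bigD1 k) //= big1 => [|i ik].
  by rewrite linearZ /= (coord_free _ _ (basis_free basisX)) eqxx mulr1 addr0.
rewrite linearZ /= (coord_free _ _ (basis_free basisX)).
case: eqP => [/enum_val_inj ki|]; last by rewrite mulr0.
by rewrite ki eqxx in ik.
Qed.

End SimpleRoots.

(** * Rank of the coadjoint forms of g *)

Fixpoint mxpow (R : pzRingType) n (A : 'M[R]_n) k : 'M[R]_n :=
  if k is k'.+1 then A *m mxpow A k' else 1%:M.

Lemma mxpowSr (R : pzRingType) n (A : 'M[R]_n) k : A *m mxpow A k = mxpow A k *m A.
Proof. by elim: k => [|k IH] /=; rewrite ?mulmx1 ?mul1mx // {1}IH mulmxA. Qed.

Lemma map_mxpow (R S : pzRingType) (f : {rmorphism R -> S}) n (A : 'M[R]_n) k :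
  map_mx f (mxpow A k) = mxpow (map_mx f A) k.
Proof. by elim: k => [|k IH] /=; rewrite ?map_mx1 // map_mxM IH. Qed.

(** A Vandermonde argument with repeated nodes: the polynomial [q] vanishes at all nodes other than
    [l i0], so the combination of the equations that it defines isolates a positive multiple of q(l
    i0) [w i0]. *)
Lemma sum_powers_eq0 (K : numFieldType) N (l w : 'I_N -> K) :
  (forall k : 'I_N.+1, \sum_i l i ^+ k * w i = 0) ->
  (forall i j, l i = l j -> w i = w j) -> forall i, w i = 0.
Proof.
move=> lw lE i0.
pose q := \prod_(j <- [seq j <- enum 'I_N | l j != l i0]) ('X - (l j)%:P).
have sq : (size q <= N.+1)%N.
  by rewrite size_prod_XsubC ltnS size_filter (leq_trans (count_size _ _)) ?size_enum_ord.
have sum0 : \sum_i q.[l i] * w i = 0.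
  under eq_bigr => i _ do rewrite (horner_coef_wide _ sq) mulr_suml.
  rewrite exchange_big big1 // => k _ /=.
  by under eq_bigr => i _ do rewrite -mulrA; rewrite -mulr_sumr lw mulr0.
have qi j : q.[l j] = if l j == l i0 then q.[l i0] else 0.
  case: eqP => [-> //|/eqP ji]; apply/eqP; rewrite horner_prod prodf_seq_eq0.
  apply/hasP; exists j; first by rewrite mem_filter /= ji mem_enum.
  by rewrite /= hornerXsubC subrr.
have q0 : q.[l i0] != 0.
  rewrite horner_prod prodf_seq_neq0; apply/allP => j; rewrite mem_filter => /andP[ji _].
  by rewrite !hornerE subr_eq0 eq_sym.
move: sum0; rewrite (bigID (fun j => l j == l i0)) /= [X in _ + X]big1 ?addr0 => [|j ji]; last first.
  by rewrite qi (negPf ji) mul0r.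
under eq_bigr => j ji do rewrite qi ji (lE _ _ (eqP ji)).
rewrite sumr_const => /eqP; rewrite mulrn_eq0 mulf_eq0 (negPf q0) /=.
case/orP => [|/eqP //]; rewrite -leqn0 leqNgt => /negP[]; apply/card_gt0P; exists i0.
exact: eqxx.
Qed.

Section CoadjointIndex.
Variables (K : numFieldType) (g : lieAlgType K) (h : {vspace g}).
Local Notation weight := 'Hom(subvs_of h, K^o).
Variable P : seq weight.
Hypotheses (g_simple : lie_simple g) (td : triangular_decomposition P).
Variables (N : nat) (X : N.-tuple g) (wt : 'I_N -> weight).
Hypothesis wb : weight_basis P X wt.
Implicit Types (a b c : weight) (x y z t : g).

Local Notation adm := (adm X).
Local Notation kil := (kil X).
Local Notation basisX := (wb_basis wb).

Lemma exists_separating : exists2 x0, x0 \in h &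
  forall i j, ev (wt i) x0 = ev (wt j) x0 -> wt i = wt j.
Proof.
(* A point of [h] at which no nonzero difference of weights vanishes. *)
pose s := [seq a <- [seq wt i - wt j | i <- enum 'I_N, j <- enum 'I_N] | a != 0].
have [|v vs] := @exists_nonvanishing _ _ s; first by rewrite mem_filter eqxx.
exists (vsval v) => [|i j /eqP]; first exact: subvsP.
rewrite -subr_eq0 -evB /ev vsvalK => e; apply/eqP; rewrite -subr_eq0; apply: contraLR e => ij.
apply: vs; rewrite mem_filter ij /=; apply/allpairsP; exists (i, j).
by rewrite !mem_enum.
Qed.

(* Row j holds the values at X_j of the differentials of the invariants tr (ad x)^(k+1). *)
Definition dinv (A : 'M[K]_N) : 'M[K]_(N, N.+1) :=
  \matrix_(j, k) \tr (mxpow A k *m adm X`_j).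

Lemma rowv_dinv A x k : (rowv X x *m dinv A) 0 k = \tr (mxpow A k *m adm x).
Proof.
rewrite mxE {2}(coordE basisX x) linear_sum mulmx_sumr linear_sum; apply: eq_bigr => j _ /=.
by rewrite linearZ -scalemxAr linearZ /= !mxE.
Qed.

(** The rows of [adm x] are the coordinates of the [x, X_i], and tr((ad x)^k [ad x, ad y]) = 0 by
    cyclicity: the differential of an invariant at x kills [x, g]. *)
Lemma adm_dinv x : adm x *m dinv (adm x) = 0.
Proof.
apply/row_matrixP => i; rewrite row_mul row0; apply/rowP => k.
have -> : row i (adm x) = rowv X [lie x, X`_i] by apply/rowP => j; rewrite !mxE.
rewrite rowv_dinv (adm_lie basisX) mulmxBr linearB /= !mulmxA.
by rewrite [X in X - _]mxtrace_mulC mulmxA mxpowSr subrr [RHS]mxE.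
Qed.

Lemma mxpow_h x0 k i j : x0 \in h ->
  mxpow (adm x0) k i j = ev (wt i) x0 ^+ k *+ (i == j).
Proof.
move=> hx; elim: k i j => [|k IH] i j /=; first by rewrite mxE expr0.
rewrite mxE (bigD1 i) //= big1 => [|l li].
  by rewrite (adm_h wb) // eqxx IH addr0 exprS mulrnAr.
by rewrite (adm_h wb) // eq_sym (negPf li) mul0r.
Qed.

(** At a separating [x0], row vectors coming from y in [h] are sent to the sums of wt_i(x0)^k
    wt_i(y); by [sum_powers_eq0] these vanish for all k only if every weight is 0 at y, that is y =
    0. *)
Lemma rank_dinv : exists2 x0, x0 \in h & (\dim h <= \rank (dinv (adm x0)))%N.
Proof.
have [x0 hx sep] := exists_separating; exists x0 => //.
pose B : 'M[K]_(\dim h, N) := \matrix_i rowv X (vbasis h)`_i.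
suff /eqP <- : row_free (B *m dinv (adm x0)) by apply: mxrankM_maxr.
apply: inj_row_free => v vB.
pose y := \sum_i v 0 i *: (vbasis h)`_i.
have hy : y \in h by apply: memv_suml => i _; rewrite memvZ // vbasis_mem // mem_nth ?size_tuple.
have yE : rowv X y = v *m B.
  rewrite /y linear_sum mulmx_sum_row; apply: eq_bigr => i _ /=.
  by rewrite linearZ /= rowK.
have y0 : y = 0.
  apply: (weights_separate g_simple td wb) => // i.
  apply: (@sum_powers_eq0 _ _ (fun i => ev (wt i) x0) (fun i => ev (wt i) y)) => [k|i1 j /sep -> //].
  have := rowv_dinv (adm x0) y k; rewrite yE -mulmxA vB mxE => E.
  rewrite [RHS]E; apply: eq_bigr => j _; rewrite mxE (bigD1 j) //= big1 ?addr0 => [|l lj].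
    by rewrite mxpow_h // (adm_h wb) // eqxx.
  by rewrite mxpow_h // eq_sym (negPf lj) mul0r.
have /freeP fB := basis_free (vbasisP h).
by apply/rowP => i; rewrite mxE; apply: fB.
Qed.

(** On the line from [x] to the point of [rank_dinv], a generic point has both ranks at least as
    large as at the respective ends; there [adm_dinv] bounds their sum by [N]. *)
Lemma rank_adm x : (\rank (adm x) + \dim h <= N)%N.
Proof.
have [x0 _ rx0] := rank_dinv.
pose xs s := x + s *: (x0 - x).
pose A : 'M[{poly K}]_N := map_mx polyC (adm x) + 'X *: map_mx polyC (adm (x0 - x)).
pose W : 'M[{poly K}]_(N, N.+1) := \matrix_(j, k) \tr (mxpow A k *m map_mx polyC (adm X`_j)).
have AE s : map_mx (horner_eval s) A = adm (xs s).
  by apply/matrixP => i j; rewrite /xs linearD linearZ /= !mxE /horner_eval !hornerE.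
have WE s : map_mx (horner_eval s) W = dinv (adm (xs s)).
  apply/matrixP => j k; rewrite mxE [W _ _]mxE [RHS]mxE -trace_map_mx map_mxM map_mxpow AE.
  by congr (\tr (_ *m _)); apply/matrixP => i l; rewrite !mxE /= /horner_eval hornerC.
have [p p0 pr] := mxrank_horner_generic A 0.
have [q q1 qr] := mxrank_horner_generic W 1.
have : p * q != 0.
  by rewrite mulf_neq0 //; [apply: contraNneq p0 | apply: contraNneq q1] => ->; rewrite horner0.
case/exists_nonroot => s; rewrite hornerM mulf_eq0 negb_or => /andP[/pr + /qr].
have [x00 x01] : xs 0 = x /\ xs 1 = x0 by rewrite /xs scale0r addr0 scale1r addrC subrK.
rewrite !AE !WE x00 x01 => rA rW.
apply: leq_trans (mulmx0_rank_max (adm_dinv (xs s))).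
by rewrite leq_add // (leq_trans rx0).
Qed.

Lemma gram_unit : (\matrix_(i < N, j < N) kil X`_i X`_j) \in unitmx.
Proof.
rewrite -row_free_unit; apply: inj_row_free => v /rowP vG.
rewrite -(rowv_surj basisX v); set y := \sum_i _.
suff -> : y = 0 by rewrite linear0.
apply: (kil_nondeg g_simple td wb) => z; rewrite (coordE basisX z) linear_sum big1 // => j _ /=.
rewrite linearZ /=; suff -> : kil y X`_j = 0 by rewrite mulr0.
have := vG j; rewrite !mxE => E; rewrite -[RHS]E kilC linear_sum; apply: eq_bigr => i _ /=.
by rewrite linearZ /= mxE kilC.
Qed.

(** Nondegeneracy writes the form [l] as kappa(x, -); by invariance its matrix is [adm x] times the
    Gram matrix. *)
Lemma rank_coad (l : 'I_N -> K) :
  (\rank (\matrix_(i < N, j < N) (\sum_k coord X k [lie X`_i, X`_j] * l k)%R) + \dim h <= N)%N.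
Proof.
set G := \matrix_(i < N, j < N) kil X`_i X`_j.
pose v := (\row_k l k) *m invmx G; pose x := \sum_i v 0 i *: X`_i.
have kx (k : 'I_N) : kil x X`_k = l k.
  have : (v *m G) 0 k = l k by rewrite /v mulmxKV ?gram_unit // mxE.
  move=> <-; rewrite mxE kilC linear_sum; apply: eq_bigr => i _ /=.
  by rewrite linearZ /= [G _ _]mxE kilC.
have -> : (\matrix_(i < N, j < N) \sum_k coord X k [lie X`_i, X`_j] * l k) = adm x *m G.
  apply/matrixP => i j; rewrite !mxE.
  transitivity (kil x [lie X`_i, X`_j]).
    rewrite {2}(coordE basisX [lie X`_i, X`_j]) linear_sum; apply: eq_bigr => k _ /=.
    by rewrite linearZ /= kx.
  rewrite -(kil_inv basisX) kilC {1}(coordE basisX [lie x, X`_i]) linear_sum.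
  by apply: eq_bigr => k _ /=; rewrite linearZ /= !mxE kilC.
apply: leq_trans (rank_adm x); rewrite leq_add2r; exact: mxrankM_maxl.
Qed.

End CoadjointIndex.

(** * Index of the contraction *)

(** Left kernel vectors of the matrix of the form are coordinates of elements of the stabilizer, and
    rank-nullity counts them. *)
Lemma leq_dim_coad_stab (K : fieldType) (V : vectType K) (L : lieAlgType K) N
    (X : N.-tuple V) (theta : {linear V -> L}) (ell : 'Hom(L, K^o)) :
  basis_of fullv X -> injective theta -> (forall y, exists x, theta x = y) ->
  (N <= \dim (coad_stab ell) +
     \rank (\matrix_(i < N, j < N) (ell [lie theta X`_i, theta X`_j] : K)%R))%N.
Proof.
move=> bX inj surj; set M := \matrix_(i, j) _.
rewrite addnC -leq_subLR -mxrank_ker.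
pose B := row_base (kermx M).
have BM : B *m M = 0 by apply/sub_kermxP; rewrite eq_row_base.
pose f (r : 'I_(\rank (kermx M))) : L := theta (\sum_i B r i *: X`_i).
pose T := [tuple f r | r < \rank (kermx M)].
have Tn (r : 'I_(\rank (kermx M))) : T`_r = f r by rewrite -tnth_nth tnth_mktuple.
have fT : free T.
  apply/freeP => c; under eq_bigr => r _ do rewrite Tn -linearZ.
  rewrite -linear_sum -(linear0 theta) => /inj E.
  have cB : (\row_r c r) *m B = 0.
    apply/rowP => i; rewrite [RHS]mxE; move: (congr1 (coord X i) E).
    rewrite linear0 linear_sum => <-; rewrite mxE; apply: eq_bigr => r _ /=.
    rewrite mxE linearZ /= linear_sum (bigD1 i) //= big1 => [|j ji].
      by rewrite linearZ /= (coord_free _ _ (basis_free bX)) eqxx mulr1 addr0.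
    by rewrite linearZ /= (coord_free _ _ (basis_free bX)) (negPf ji) mulr0.
  move=> r; have /row_free_inj inB := row_base_free (kermx M).
  have : \row_r c r = 0 by apply: inB; rewrite cB mul0mx.
  by move/rowP/(_ r); rewrite !mxE.
move: fT; rewrite /free size_tuple => /eqP <-; apply: dimvS.
apply/span_subvP => _ /tnthP[r ->]; rewrite tnth_mktuple; apply/coad_stabP => y.
have [x <-] := surj y; rewrite (coord_basis bX (memvf x)) !linear_sum big1 // => j _ /=.
rewrite !linearZ /=; suff -> : ell [lie f r, theta X`_j] = 0 by rewrite scaler0.
move/matrixP/(_ r j): BM; rewrite !mxE => E; rewrite -[RHS]E.
rewrite /f linear_sum lie_suml linear_sum; apply: eq_bigr => i _ /=.
by rewrite linearZ /= lieZl linearZ [M i j]mxE.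
Qed.

Section Contraction.
Variables (K : numFieldType) (g : lieAlgType K) (h : {vspace g}).
Local Notation weight := 'Hom(subvs_of h, K^o).
Variable P : seq weight.
Hypotheses (g_simple : lie_simple g) (td : triangular_decomposition P).
Variables (N : nat) (X : N.-tuple g) (wt : 'I_N -> weight).
Hypothesis wb : weight_basis P X wt.
Implicit Types (a b c : weight) (x y z t : g).

Local Notation adm := (adm X).
Local Notation kil := (kil X).
Local Notation basisX := (wb_basis wb).
Local Notation bo := (borel td).
Local Notation q := (semidirect (quot_rep bo)).
Local Notation nge i := (- wt i \in P).

Lemma basis_borel i : ~~ nge i -> X`_i \in (bo : {vspace g}).
Proof.
move=> ni; case: (wb_cases wb i) => [w0|Pi|]; last by rewrite (negPf ni).
  by apply: subvP (addvSl _ _) _ _; apply: (wb_cartan wb).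
apply: subvP (addvSr _ _) _ _.
apply: (subvP (sumv_seq_sup (@root_space K g h) Pi)); exact: (wb_root wb).
Qed.

Lemma coord_borel x i : x \in (bo : {vspace g}) -> coord X i x != 0 -> ~~ nge i.
Proof.
move=> /memv_addP[t ht [n nn ->]]; apply: contraNN => ni; rewrite linearD /=.
have -> : coord X i t = 0.
  apply: contrapT => /eqP /(coord_wt wb (h_root0 g_simple td wb ht)) w0.
  by have := P_0 td; rewrite -oppr0 -w0 ni.
suff -> : coord X i n = 0 by rewrite addr0.
have : (n_plus P <= lker (linfun (coord X i : g -> K^o)))%VS.
  apply: sumv_seq_sub => a Pa; apply/subvP => y ya; rewrite memv_ker lfunE /=.
  apply: contraT => /(coord_wt wb ya) wa.
  by have := P_opp td Pa; rewrite -wa ni.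
by move/subvP/(_ n nn); rewrite memv_ker lfunE => /eqP.
Qed.

Lemma lie_borel x y : x \in (bo : {vspace g}) -> y \in (bo : {vspace g}) ->
  [lie x, y] \in (bo : {vspace g}).
Proof. by move=> bx yb; apply: (lsvalP bx yb). Qed.

(** The projection of [g] onto b along n_-; [nge i] marks the basis vectors of n_-. *)
Definition prb (x : g) : g := \sum_(i | ~~ nge i) coord X i x *: X`_i.

Fact prb_is_linear : linear prb.
Proof.
move=> a x y; rewrite /prb scaler_sumr -big_split; apply: eq_bigr => i _ /=.
by rewrite linearP scalerDl scalerA.
Qed.
HB.instance Definition _ := GRing.isLinear.Build K g g _ prb prb_is_linear.

Lemma prb_mem x : prb x \in (bo : {vspace g}).
Proof. by apply: memv_suml => i ni; rewrite memvZ // basis_borel. Qed.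

Lemma prb_id x : x \in (bo : {vspace g}) -> prb x = x.
Proof.
move=> bx; rewrite [RHS](coordE basisX) [RHS](bigID (fun i => ~~ nge i)) /=.
rewrite [X in _ + X]big1 ?addr0 // => i ni.
have [->|/(coord_borel bx)] := eqVneq (coord X i x) 0; first by rewrite scale0r.
by rewrite (negPf ni).
Qed.

Lemma prb_basis (i : 'I_N) : prb X`_i = if nge i then 0 else X`_i.
Proof.
case: ifP => ni; last by rewrite prb_id // basis_borel // ni.
apply: big1 => j nj; rewrite (coord_free _ _ (basis_free basisX)).
case: eqP => [ij|]; last by rewrite scale0r.
by rewrite -ij ni in nj.
Qed.

(** A linear identification of [g] with the semidirect product, n_- standing for g/b. It does not
    preserve brackets; [lie_theta] measures the defect. *)
Definition theta (x : g) : q := (piv bo x, Subvs (prb_mem x)).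

Fact theta_is_linear : linear theta.
Proof.
move=> a x y; congr pair; first exact: linearP.
by apply: val_inj; rewrite /= linearP.
Qed.
HB.instance Definition _ := GRing.isLinear.Build K g q _ theta theta_is_linear.

Lemma theta_inj : injective theta.
Proof.
move=> x y E; apply/eqP; rewrite -subr_eq0.
have [/eq_pivP bxy /(congr1 vsval) /= pxy] := (congr1 fst E, congr1 snd E).
by rewrite -(prb_id bxy) linearB /= pxy subrr.
Qed.

Lemma theta_surj p : exists x, theta x = p.
Proof.
case: p => v y; exists (repr v - prb (repr v) + vsval y).
congr pair; last first.
  by apply: val_inj; rewrite /= linearD linearB /= !(prb_id (prb_mem _)) subrr add0r prb_id ?subvsP.
rewrite -[RHS](reprK_piv v); apply/eq_pivP.
by rewrite addrAC [repr v - _]addrC addrK memvD ?subvsP ?memvN ?prb_mem.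
Qed.

Lemma piv_prb x : piv bo (x - prb x) = piv bo x.
Proof.
apply/eq_pivP; rewrite addrAC subrr add0r memvN; exact: prb_mem.
Qed.

Lemma piv_borel x : x \in (bo : {vspace g}) -> piv bo x = 0.
Proof. by move=> bx; rewrite -(linear0 (piv bo)); apply/eq_pivP; rewrite subr0. Qed.

Lemma theta_prb x : theta (prb x) = (0, Subvs (prb_mem x)).
Proof.
congr pair; first by rewrite piv_borel ?prb_mem.
by apply: val_inj; rewrite /= prb_id ?prb_mem.
Qed.

Lemma theta_prbC x : theta (x - prb x) = (piv bo x, 0).
Proof.
congr pair; first exact: piv_prb.
by apply: val_inj; rewrite /= linearB /= (prb_id (prb_mem x)) subrr.
Qed.

(** The contraction: compared with [g], brackets inside n_- are dropped, and mixed brackets lose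
    their component in b. *)
Lemma lie_theta (i j : 'I_N) : [lie theta X`_i, theta X`_j] =
  let z := [lie X`_i, X`_j] in
  if nge i then (if nge j then 0 else theta (z - prb z))
  else if nge j then theta (z - prb z) else theta (prb z).
Proof.
rewrite /= theta_prb theta_prbC quot_semidirectE; case: ifP => ni; case: ifP => nj; congr pair.
- by rewrite /= !prb_basis ni nj !lie0l linear0 subr0.
- by apply: val_inj; rewrite /= !prb_basis ni lie0l.
- by rewrite /= !prb_basis ni nj lie0l linear0 sub0r -linearN /= -lieC.
- by apply: val_inj; rewrite /= !prb_basis ni lie0l.
- by rewrite /= !prb_basis ni nj lie0l linear0 subr0.
- by apply: val_inj; rewrite /= !prb_basis nj linear0.
- rewrite /= !prb_basis ni nj !piv_borel ?subr0 //;
  by apply: lie_borel; apply: basis_borel; rewrite ?ni ?nj.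
- apply: val_inj; rewrite /= !prb_basis ni nj prb_id //.
  by apply: lie_borel; apply: basis_borel; rewrite ?ni ?nj.
Qed.

Lemma prbC x : x - prb x = \sum_(i | nge i) coord X i x *: X`_i.
Proof.
rewrite {1}(coordE basisX x) (bigID (fun i => nge i)) /= addrK //.
Qed.

(* The brackets of q are the value at s = 0 of a family of brackets that are
   equivalent to that of g for s <> 0, through the map that is s on n_- and 1 on b. *)
Lemma leq_dim_h_stab (ell : 'Hom(q, K^o)) : (\dim h <= \dim (coad_stab ell))%N.
Proof.
have := leq_dim_coad_stab (theta := theta) ell basisX theta_inj theta_surj.
set M0 := \matrix_(i, j) _.
pose l k : K := ell (theta X`_k).
pose m (i : 'I_N) : nat := nge i.
pose c i j k : K := coord X k [lie X`_i, X`_j] * l k.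
have c0 (i j k : 'I_N) : ~~ nge i -> ~~ nge j -> nge k -> c i j k = 0.
  move=> ni nj nk; rewrite /c.
  have /(@coord_borel _ k) := lie_borel (basis_borel ni) (basis_borel nj).
  by rewrite nk; have [->|_ /(_ isT)] := eqVneq (coord X k [lie X`_i, X`_j]) 0; rewrite ?mul0r.
(* The exponent is a truncated difference. It would be negative only for i, j in b and k in n_-,
   where the coefficient is 0 by [c0] since b is a subalgebra. *)
pose M : 'M[{poly K}]_N := \matrix_(i, j) \sum_k c i j k *: 'X^(m i + m j - m k).
have M0E : map_mx (horner_eval 0) M = M0.
  apply/matrixP => i j; rewrite !mxE lie_theta /horner_eval horner_sum /=.
  under eq_bigr => k _ do rewrite hornerZ hornerXn expr0n.
  have E (S : pred 'I_N) x : ell (theta (\sum_(k | S k) coord X k x *: X`_k)) =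
      \sum_k (if S k then coord X k x * l k else 0).
    by rewrite !linear_sum -big_mkcond; apply: eq_bigr => k _ /=; rewrite !linearZ.
  case: ifP => ni; case: ifP => nj; rewrite ?prbC /prb ?linear0 ?E /m ?ni ?nj.
  - by apply: big1 => k _; case: (nge k); rewrite mulr0.
  - by apply: eq_bigr => k _; case: (nge k); rewrite ?mulr1 ?mulr0.
  - by apply: eq_bigr => k _; case: (nge k); rewrite ?mulr1 ?mulr0.
  - apply: eq_bigr => k _; case nk: (nge k); rewrite ?mulr1 //.
    by rewrite c0 ?ni ?nj // mul0r.
(* For nonzero [s] the matrix is congruent, through the diagonal [D], to that of a form on [g] with
   rescaled values. *)
have Ms s : s != 0 -> (\rank (map_mx (horner_eval s) M) + \dim h <= N)%N.
  move=> s0; apply: leq_trans (rank_coad g_simple td wb (fun k => l k / s ^+ m k)).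
  rewrite leq_add2r; set G := (X in (_ <= \rank X)%N).
  pose D := diag_mx (\row_i s ^+ m i).
  suff -> : map_mx (horner_eval s) M = D *m G *m D.
    exact: leq_trans (mxrankM_maxl _ _) (mxrankM_maxr _ _).
  apply/matrixP => i j; rewrite mul_mx_diag mul_diag_mx !mxE /horner_eval horner_sum.
  rewrite mulr_sumr mulr_suml; apply: eq_bigr => k _; rewrite hornerZ hornerXn.
  case: (boolP [&& ~~ nge i, ~~ nge j & nge k]) => [/and3P[ni nj nk]|ijk].
    have := c0 _ _ _ ni nj nk; rewrite /c => /eqP; rewrite mulf_eq0 => /orP[] /eqP ->;
    by rewrite ?(mulr0, mul0r).
  have le : (m k <= m i + m j)%N.
    by move: ijk; rewrite /m; case: (nge i); case: (nge j); case: (nge k).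
  have -> : s ^+ (m i + m j - m k) = s ^+ m i * s ^+ m j / s ^+ m k.
    by rewrite expfB_cond ?(negPf s0) ?add0n // exprD.
  have mulE (a b u v d : K) : u * v * (a * b * d) = a * (u * (v * d)) * b by ring.
  exact: mulE.
have [p p0 pr] := mxrank_horner_generic M 0.
(* The factor X keeps the generic value away from 0. *)
have : p * 'X != 0.
  by rewrite mulf_neq0 ?polyX_eq0 //; apply: contraNneq p0 => ->; rewrite horner0.
case/exists_nonroot => s; rewrite hornerM hornerX mulf_eq0 negb_or => /andP[/pr + /Ms].
rewrite M0E => r1 r2 r3; rewrite -(leq_add2l (\rank M0)) [leqRHS]addnC.
by apply: leq_trans r3; apply: leq_trans r2; rewrite leq_add2r.
Qed.

Lemma coord_prbC x i : coord X i (x - prb x) != 0 -> nge i.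
Proof.
rewrite prbC linear_sum; apply: contra_neqT => ni; apply: big1 => k nk /=.
rewrite linearZ /= (coord_free _ _ (basis_free basisX)); case: eqP => [ki|]; last by rewrite mulr0.
by rewrite -ki nk in ni.
Qed.

Lemma card_weights : (#|[pred i | ~~ nge i]| = \dim h + #|[pred i | wt i \in P]|)%N.
Proof.
rewrite (perm_basis_card (S := [pred i | wt i == 0]) basisX) => [|i /eqP|x i hx].
- rewrite -cardUI [X in _ = (_ + X)%N]eq_card0 ?addn0; last first.
    move=> i; rewrite !inE; apply/negP => /andP[/eqP -> P0].
    by have := P_0 td; rewrite P0.
  apply: eq_card => i; rewrite !inE.
  apply/idP/orP => [ni|[/eqP ->|Pi]].
  - by case: (wb_cases wb i) => [->|->|]; [left|right|rewrite (negPf ni)].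
  - by rewrite oppr0 P_0.
  - exact: (P_opp td).
- exact: (wb_cartan wb).
- by move/(coord_wt wb (h_root0 g_simple td wb hx))/eqP.
Qed.

(** * The stabilizer of kappa(e, -) *)

Section UpperBound.
Variable e : g.
Hypotheses (eb : forall j : 'I_N, - wt j \notin P -> kil e X`_j = 0)
  (ew : forall w, (forall i, coord X i w != 0 -> - wt i \in P) ->
      (forall i : 'I_N, - wt i \notin P -> kil e [lie X`_i, w] = 0) -> w = 0).

Lemma kil_e_borel x : x \in (bo : {vspace g}) -> kil e x = 0.
Proof.
move=> bx; rewrite (coordE basisX x) linear_sum big1 // => i _ /=; rewrite linearZ /=.
have [->|/(coord_borel bx)/eb ->] := eqVneq (coord X i x) 0; first by rewrite mul0r.
by rewrite mulr0.
Qed.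

(** The form kappa(e, -) on g/b, extended by 0 to b. The choice of representative is harmless
    because [e] is orthogonal to b. *)
Definition xi (p : q) : K^o := kil e (repr p.1).

Lemma xiE p w : p.1 = piv bo w -> xi p = kil e w.
Proof.
move=> pw; apply/eqP; rewrite -subr_eq0 -linearB /=; apply/eqP/kil_e_borel.
by apply/eq_pivP; rewrite reprK_piv.
Qed.

Fact xi_is_linear : linear xi.
Proof.
move=> c u v; rewrite (@xiE _ (c *: repr u.1 + repr v.1)); last by rewrite [RHS]linearP /= !reprK_piv.
exact: linearP.
Qed.
HB.instance Definition _ := GRing.isLinear.Build K q K^o _ xi xi_is_linear.

Local Notation ell := (linfun xi).

(** Testing against the ideal g/b and against b separately splits the condition in two. *)
Lemma xi_stab p : p \in coad_stab ell -> forall (w : g) (y : subvs_of bo),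
  kil e [lie vsval p.2, w] = 0 /\ kil e [lie vsval y, repr p.1] = 0.
Proof.
move=> /coad_stabP st.
have E (w : g) (y : subvs_of bo) :
    kil e ([lie vsval p.2, w] - [lie vsval y, repr p.1]) = 0.
  have := st (piv bo w, y); rewrite lfunE /= => <-; apply/esym/xiE.
  have -> : piv bo ([lie vsval p.2, w] - [lie vsval y, repr p.1]) =
      quot_act p.2 (piv bo w) - quot_act y (piv bo (repr p.1)).
    by rewrite !quot_actE; apply: linearB.
  by rewrite reprK_piv.
move=> w y; split; first by have := E w 0; rewrite /= lie0l subr0.
have := E 0 y; rewrite linear0 sub0r -[in LHS]scaleN1r linearZ /= mulN1r.
by move/eqP; rewrite oppr_eq0 => /eqP.
Qed.

(** The stabilizer meets g/b trivially: the n_- part of a representative of [p.1] satisfies the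
    hypotheses of [ew]. *)
Lemma xi_stab_inj p : p \in coad_stab ell -> vsval p.2 = 0 -> p = 0.
Proof.
move=> st p2; pose w := repr p.1 - prb (repr p.1).
have w0 : w = 0.
  apply: ew => [i|i ni]; first exact: coord_prbC.
  rewrite linearB linearB /= [X in _ - X]kil_e_borel ?subr0.
    by have [_] := xi_stab st 0 (Subvs (basis_borel ni)).
  by apply: lie_borel; rewrite ?prb_mem // basis_borel.
have p1 : p.1 = 0 by rewrite -[p.1]reprK_piv -piv_prb -/w w0 linear0.
by case: p p1 p2 {st w w0} => u y /= -> y0; congr pair; apply: val_inj.
Qed.

(** The stabilizer embeds in b ([V]), with image in the left kernel of the pairing [A] of b with
    n_-. As [A] has rank dim n_-, its dimension is at most dim b - dim n_- = dim h + dim n_+ - dim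
    n_-, and dim n_+ is at most dim n_-. *)
Lemma dim_xi_stab : (\dim (coad_stab ell) <= \dim h)%N.
Proof.
pose B := [pred i | ~~ nge i]; pose C := [pred i | nge i]; set d := \dim _.
pose u (k : 'I_d) := (vbasis (coad_stab ell))`_k.
have us k : u k \in coad_stab ell by apply: vbasis_mem; rewrite mem_nth // size_tuple.
pose V : 'M[K]_(d, #|B|) := \matrix_(k, i) coord X (@enum_val _ B i) (vsval (u k).2).
pose A : 'M[K]_(#|B|, #|C|) :=
  \matrix_(i, j) kil e [lie X`_(@enum_val _ B i), X`_(@enum_val _ C j)].
have rV : row_free V.
  apply: inj_row_free => v /rowP vV.
  pose p := \sum_k v 0 k *: u k.
  have p2E : vsval p.2 = \sum_k v 0 k *: vsval (u k).2.
    rewrite /p; elim/big_rec2: _ => [//|k x y _ <- /=]; by [].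
  have ps : p \in coad_stab ell by apply: memv_suml => k _; rewrite memvZ.
  have p20 : vsval p.2 = 0.
    apply: (coord_inj basisX) => i; have bp : vsval p.2 \in (bo : {vspace g}) := subvsP _.
    apply: contrapT => /eqP nz; have ni := coord_borel bp nz.
    have Bi : i \in B by [].
    case/eqP: nz; have := vV (enum_rank_in Bi i); rewrite !mxE => E; rewrite -[RHS]E p2E linear_sum.
    by apply: eq_bigr => k _; rewrite linearZ /= mxE enum_rankK_in.
  have p0 := xi_stab_inj ps p20.
  have /freeP fu := basis_free (vbasisP (coad_stab ell)).
  by apply/rowP => k; rewrite mxE; apply: fu.
have VA : V *m A = 0.
  apply/matrixP => k j; rewrite [RHS]mxE mxE.
  have [E _] := xi_stab (us k) X`_(@enum_val _ C j) 0; rewrite -[RHS]E.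
  have bu : vsval (u k).2 \in (bo : {vspace g}) := subvsP _.
  rewrite [in RHS](coordE basisX (vsval (u k).2)) lie_suml linear_sum /=.
  rewrite (bigID (mem B)) /= [X in _ + X]big1 ?addr0 => [|i nB].
    rewrite [RHS]big_enum_val /=; apply: eq_bigr => i _.
    by rewrite !mxE lieZl linearZ.
  have [->|/(coord_borel bu) Bi] := eqVneq (coord X i (vsval (u k).2)) 0.
    by rewrite scale0r lie0l linear0.
  by rewrite inE Bi in nB.
(* A vector in the right kernel of [A] is an element of n_- to which [ew] applies. *)
have rA : \rank A = #|C|.
  rewrite -mxrank_tr; apply/eqP; apply: inj_row_free => v /rowP vA.
  pose w := \sum_j v 0 j *: X`_(@enum_val _ C j).
  have wE i : coord X i w = \sum_j v 0 j * (@enum_val _ C j == i)%:R.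
    rewrite linear_sum; apply: eq_bigr => j _ /=.
    by rewrite linearZ /= (coord_free _ _ (basis_free basisX)).
  have w0 : w = 0.
    apply: ew => [i|i ni].
      rewrite wE => nz; have [j nj] := sum_neq0_exists nz; move: nj.
      case: (eqVneq (@enum_val _ C j) i) => [<- _|_]; last by rewrite mulr0 eqxx.
      exact: (@enum_valP _ C j).
    have Bi : i \in B by [].
    have := vA (enum_rank_in Bi i); rewrite !mxE => E; rewrite -[RHS]E linear_sum linear_sum.
    by apply: eq_bigr => j _; rewrite !linearZ /= !mxE enum_rankK_in.
  apply/rowP => j; rewrite mxE; have := wE (@enum_val _ C j); rewrite w0 linear0.
  rewrite (bigD1 j) //= eqxx mulr1 big1 ?addr0 => [-> //|k kj].
  by case: eqP => [/enum_val_inj kj'|]; rewrite ?mulr0 // kj' eqxx in kj *.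
have := mulmx0_rank_max VA; rewrite (eqP rV) rA /B card_weights => le.
have le' := card_pos_le_neg g_simple td wb.
rewrite -(leq_add2r #|C|); apply: leq_trans le _; by rewrite leq_add2l.
Qed.

End UpperBound.

Lemma ind_borel_quotient : ind q = \dim h.
Proof.
apply/eqP; rewrite eqn_leq; apply/andP; split.
  have [e eb ew] := exists_regular_nilpotent g_simple td wb.
  exact: leq_trans (ind_le _) (dim_xi_stab eb ew).
by have [ell <-] := ind_attained q; apply: leq_dim_h_stab.
Qed.

End Contraction.

Local Open Scope complex_scope.

Theorem mainTheorem6 (R : realType) (g : lieAlgType R[i]) (h : {vspace g})
    (P : seq 'Hom(subvs_of h, R[i]^o))
    (g_simple : lie_simple g) (td : triangular_decomposition P) :
  ind (semidirect (quot_rep (borel td))) = \dim h.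
Proof.
have [N [X [wt wb]]] := exists_weight_basis g_simple td.
exact: (ind_borel_quotient g_simple td wb).
Qed.
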